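(* There exists an infinite connected graph $G$ such that every vertex of $G$ has degree $3$, every end of $G$ has vertex-degree $3$ and edge-degree $3$, and $|G|$ contains exactly one Hamilton circle.
   Context: All graphs are simple. An end of a graph is an equivalence class of rays (one-way infinite paths), two rays being equivalent if no finite vertex set separates them. The vertex-degree (resp. edge-degree) of an end $\omega$ is the supremum of the number of vertex-disjoint (resp. edge-disjoint) rays in $\omega$. For a locally finite connected graph $G$, $|G|$ is its Freudenthal compactification ($G$ as a 1-complex plus its ends, where for each finite $S\subseteq V(G)$ the component of $G-S$ containing tails of the rays of an end, together with its ends and inner points of edges to $S$, is an open neighbourhood of that end). A Hamilton circle is a homeomorphic image of $S^1$ in $|G|$ containing all vertices of $G$. *)

(* Defs.v *)
From Stdlib Require Import Reals Lra List ClassicalEpsilon.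
Open Scope R_scope.

Section Graphs.
Variable V : Type.
Variable adj : V -> V -> Prop.

Definition deceq (x y : V) : bool :=
  if excluded_middle_informative (x = y) then true else false.

Definition simple_graph : Prop :=
  (forall u v, adj u v -> adj v u) /\ (forall v, ~ adj v v).

Definition has_degree (v : V) (k : nat) : Prop :=
  exists l : list V, NoDup l /\ length l = k /\ forall x, adj v x <-> In x l.

Definition infinite_graph : Prop := forall l : list V, exists v, ~ In v l.

Inductive reach (A : V -> Prop) : V -> V -> Prop :=
| reach_refl u : A u -> reach A u u
| reach_step u v w : reach A u v -> adj v w -> A w -> reach A u w.

Definition connected : Prop := forall u v, reach (fun _ => True) u v.

Definition avoid (S : list V) : V -> Prop := fun x => ~ In x S.

Definition is_ray (r : nat -> V) : Prop :=
  (forall n m, r n = r m -> n = m) /\ (forall n, adj (r n) (r (S n))).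

Definition ray_equiv (r1 r2 : nat -> V) : Prop :=
  forall S : list V, exists N : nat, forall i j, (N <= i)%nat -> (N <= j)%nat ->
    reach (avoid S) (r1 i) (r2 j).

Definition is_end (E : (nat -> V) -> Prop) : Prop :=
  exists r, is_ray r /\ forall r', E r' <-> (is_ray r' /\ ray_equiv r r').

Definition has_vdisjoint_rays (E : (nat -> V) -> Prop) (k : nat) : Prop :=
  exists rs : nat -> nat -> V,
    (forall i, (i < k)%nat -> E (rs i)) /\
    (forall i j, (i < k)%nat -> (j < k)%nat -> i <> j ->
       forall n m, rs i n <> rs j m).

Definition same_edge (a b c d : V) : Prop := (a = c /\ b = d) \/ (a = d /\ b = c).

Definition has_edisjoint_rays (E : (nat -> V) -> Prop) (k : nat) : Prop :=
  exists rs : nat -> nat -> V,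
    (forall i, (i < k)%nat -> E (rs i)) /\
    (forall i j, (i < k)%nat -> (j < k)%nat -> i <> j ->
       forall n m, ~ same_edge (rs i n) (rs i (S n)) (rs j m) (rs j (S m))).

Definition end_vertex_degree (E : (nat -> V) -> Prop) (k : nat) : Prop :=
  has_vdisjoint_rays E k /\ forall m, (k < m)%nat -> ~ has_vdisjoint_rays E m.
Definition end_edge_degree (E : (nat -> V) -> Prop) (k : nat) : Prop :=
  has_edisjoint_rays E k /\ forall m, (k < m)%nat -> ~ has_edisjoint_rays E m.

(** The space |G|.
   A point of the 1-complex is given by barycentric coordinates w : V -> R
   (a vertex v is the indicator of v; the point at distance t from u on the
   edge uv has weight 1-t on u and t on v).  Ends are points of their own. *)
Inductive point : Type :=
| PW : (V -> R) -> point
| PEnd : ((nat -> V) -> Prop) -> point.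

Definition vtx (v : V) : point := PW (fun x => if deceq x v then 1 else 0).

Definition ept (u v : V) (t : R) : point :=
  PW (fun x => if deceq x u then 1 - t else if deceq x v then t else 0).

Definition inG (p : point) : Prop :=
  (exists v, p = vtx v) \/
  (exists u v t, adj u v /\ 0 <= t <= 1 /\ p = ept u v t) \/
  (exists E, is_end E /\ p = PEnd E).

Definition in_comp (S : list V) (E : (nat -> V) -> Prop) (x : V) : Prop :=
  exists r, E r /\ exists N : nat, forall i, (N <= i)%nat -> reach (avoid S) (r i) x.

Definition basic_nbhd (p : point) (Nb : point -> Prop) : Prop :=
  (exists u v t a b, adj u v /\ 0 < t < 1 /\ p = ept u v t /\
     0 <= a < t /\ t < b <= 1 /\
     forall q, Nb q <-> exists s, a < s < b /\ q = ept u v s) \/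
  (exists v eps, p = vtx v /\ 0 < eps <= 1 /\
     forall q, Nb q <-> (q = vtx v \/ exists u s, adj v u /\ 0 < s < eps /\ q = ept v u s)) \/
  (exists E (S : list V), is_end E /\ p = PEnd E /\
     forall q, Nb q <->
       ((exists x y s, adj x y /\ in_comp S E x /\ 0 <= s < 1 /\ q = ept x y s) \/
        (exists E', is_end E' /\ q = PEnd E' /\
           exists r, E' r /\ exists N : nat, forall i, (N <= i)%nat -> in_comp S E (r i)))).

Definition open_G (O : point -> Prop) : Prop :=
  forall p, inG p -> O p ->
    exists Nb, basic_nbhd p Nb /\ forall q, inG q -> Nb q -> O q.

Definition S1 (z : R * R) : Prop := (fst z) ^ 2 + (snd z) ^ 2 = 1.
Definition dist2 (z z' : R * R) : R :=
  sqrt ((fst z - fst z') ^ 2 + (snd z - snd z')^2).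

Definition is_circle (C : point -> Prop) : Prop :=
  (forall p, C p -> inG p) /\
  exists f : R * R -> point,
    (forall z, S1 z -> C (f z)) /\
    (forall p, C p -> exists z, S1 z /\ f z = p) /\
    (forall z z', S1 z -> S1 z' -> f z = f z' -> z = z') /\
    (forall O, open_G O -> forall z, S1 z -> O (f z) ->
       exists eps, 0 < eps /\ forall z', S1 z' -> dist2 z z' < eps -> O (f z')) /\
    (* the inverse of f (on C with the subspace topology) is continuous *)
    (forall z eps, S1 z -> 0 < eps ->
       exists O, open_G O /\ O (f z) /\
         forall z', S1 z' -> O (f z') -> dist2 z z' < eps).

Definition hamilton_circle (C : point -> Prop) : Prop :=
  is_circle C /\ forall v, C (vtx v).

Definition unique_hamilton_circle : Prop :=
  exists C, hamilton_circle C /\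
    forall C', hamilton_circle C' -> forall p, C' p <-> C p.

End Graphs.

(* Main.v *)
(* The graph is a bi-infinite chain of copies of a 10-vertex piece, consecutive copies being
   joined by three edges, so that it has two ends, both of degree 3.

   A circle meets every finite edge cut in an even number of edges, which is positive if the
   circle passes through all vertices and both sides are nonempty: the open sets of points on
   the two sides of the cut, minus the midpoints of the cut edges, are clopen in what is left
   of the circle.  Hence a Hamilton circle uses two edges at each vertex, two of the three
   edges between consecutive pieces, and at least one edge of every cut that separates a set
   of vertices of one piece, possibly together with everything to its left, from the rest.
   A finite check shows that, in each piece, these conditions force one of the edges on its
   left and a differently placed one on its right.  So two of the three edges between any two
   consecutive pieces are forced, and the third is unused; given this, the finite check leaves
   a single possibility inside every piece.  The resulting edges form two spanning double
   rays (k, w0) and ... (k, w1), ..., (k, w9), (k + 1, w1), ..., and these together with the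
   two ends are the image of the unit circle: the upper and the lower half circle, both
   parametrized by x / |y|, trace the double rays and (1, 0), (-1, 0) are the ends. *)

(* Parity is used only for cuts of exactly three edges, where it means excluding zero, one and three
   crossings. A partition of the vertices need not extend to the ends, since an end can be a limit
   of both sides. So every cut used is constant far to the left and far to the right, except the one
   showing that both ends lie on the circle, which assumes one end absent. Left and right are
   contracted to two different vertices because a cut may separate the ends. A cut and its
   complement have the same edges, so the right vertex can be taken outside. The forced edges sit in
   different positions, [w9 w1] on the left and [w0 w0] on the right. At each junction the piece
   after it forces the first and the piece before it the second. Knowing the used edges does not yet
   determine the circle as a point set: one inner point must bring in all inner points of its edge,
   and both ends must be shown to belong to it. The slope x / |y| maps each open half circle onto
   the whole line and tends to infinite values of the same sign at the same end, so both double rays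
   are traced from left to right. *)
Require Import Defs.
From Stdlib Require Import Reals Lra Lia ZArith List Bool.
From Stdlib Require Import ClassicalEpsilon FunctionalExtensionality PropExtensionality.
Import ListNotations.
Open Scope R_scope.

(** * Points and open sets of a graph *)

Section GraphSpace.
Variable V : Type.
Variable adj : V -> V -> Prop.
Hypothesis adj_sym : forall u v, adj u v -> adj v u.
Hypothesis adj_irrefl : forall v, ~ adj v v.

Lemma adj_neq u v : adj u v -> u <> v.
Proof. intros H ->. exact (adj_irrefl _ H). Qed.

Lemma deceq_refl (x : V) : deceq V x x = true.
Proof. unfold deceq. destruct (excluded_middle_informative (x = x)); congruence. Qed.

Lemma deceq_neq (x y : V) : x <> y -> deceq V x y = false.
Proof. intro H. unfold deceq. destruct (excluded_middle_informative (x = y)); congruence. Qed.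

Ltac deceq_cases :=
  repeat match goal with
  | |- context [deceq V ?x ?x] => rewrite (deceq_refl x)
  | H : context [deceq V ?x ?x] |- _ => rewrite (deceq_refl x) in H
  | |- context [deceq V ?x ?y] =>
      let Heq := fresh "Heq" in
      destruct (excluded_middle_informative (x = y)) as [Heq|Heq];
      [try subst | rewrite (deceq_neq x y Heq)]
  | H : context [deceq V ?x ?y] |- _ =>
      let Heq := fresh "Heq" in
      destruct (excluded_middle_informative (x = y)) as [Heq|Heq];
      [try subst | rewrite (deceq_neq x y Heq) in H]
  end.

Lemma ept_swap u v t : u <> v -> ept V u v t = ept V v u (1 - t).
Proof.
  intro H. unfold ept. f_equal. extensionality x.
  deceq_cases; try congruence; lra.
Qed.

Lemma ept_0 u v : u <> v -> ept V u v 0 = vtx V u.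
Proof.
  intro H. unfold ept, vtx. f_equal. extensionality x.
  deceq_cases; try congruence; lra.
Qed.

Lemma ept_1 u v : u <> v -> ept V u v 1 = vtx V v.
Proof.
  intro H. unfold ept, vtx. f_equal. extensionality x.
  deceq_cases; try congruence; lra.
Qed.

Lemma vtx_inj u v : vtx V u = vtx V v -> u = v.
Proof.
  intro H. injection H as H. apply (f_equal (fun g => g u)) in H. cbn beta in H.
  deceq_cases; auto. lra.
Qed.

Lemma vtx_neq_ept w u v t : u <> v -> 0 < t < 1 -> vtx V w <> ept V u v t.
Proof.
  intros H Ht E. injection E as E.
  pose proof (f_equal (fun g => g u) E) as E1. cbn beta in E1.
  deceq_cases; lra.
Qed.

(** For inner [t] both weights are positive, so the support of the weight function is the pair of
    end vertices; only the orientation of the edge remains ambiguous. *)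
Lemma ept_inj u v t u' v' t' : u <> v -> u' <> v' -> 0 < t < 1 -> 0 <= t' <= 1 ->
  ept V u v t = ept V u' v' t' ->
  (u = u' /\ v = v' /\ t = t') \/ (u = v' /\ v = u' /\ t = 1 - t').
Proof.
  intros H H' Ht Ht' E. injection E as E.
  pose proof (f_equal (fun g => g u) E) as E1. cbn beta in E1.
  pose proof (f_equal (fun g => g v) E) as E2. cbn beta in E2.
  rewrite (deceq_neq v u) in E2 by congruence. rewrite !deceq_refl in *.
  destruct (excluded_middle_informative (u = u')) as [->|N1].
  - rewrite deceq_refl in E1. rewrite (deceq_neq v u') in E2 by congruence.
    destruct (excluded_middle_informative (v = v')) as [->|N2].
    + left. repeat split. lra.
    + rewrite (deceq_neq v v') in E2 by auto. lra.
  - rewrite (deceq_neq u u') in E1 by auto.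
    destruct (excluded_middle_informative (u = v')) as [->|N2].
    + rewrite deceq_refl in E1.
      destruct (excluded_middle_informative (v = u')) as [->|N3].
      * right. repeat split. lra.
      * rewrite (deceq_neq v u'), (deceq_neq v v') in E2 by congruence. lra.
    + rewrite (deceq_neq u v') in E1 by auto. lra.
Qed.

Lemma inG_cases p : inG V adj p ->
  (exists v, p = vtx V v) \/
  (exists u v t, adj u v /\ 0 < t < 1 /\ p = ept V u v t) \/
  (exists E, is_end V adj E /\ p = PEnd V E).
Proof.
  intros [H|[(u & v & t & Huv & Ht & ->)|H]]; auto.
  pose proof (adj_neq _ _ Huv) as N.
  destruct (Req_dec t 0) as [->|T0].
  { left. exists u. apply ept_0; auto. }
  destruct (Req_dec t 1) as [->|T1].
  { left. exists v. apply ept_1; auto. }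
  right. left. exists u, v, t. repeat split; auto; lra.
Qed.

Lemma inG_vtx v : inG V adj (vtx V v).
Proof. left. eauto. Qed.

Lemma inG_ept u v t : adj u v -> 0 <= t <= 1 -> inG V adj (ept V u v t).
Proof. intros. right. left. exists u, v, t. auto. Qed.

Lemma open_G_edge O u v t : open_G V adj O -> adj u v -> 0 < t < 1 -> O (ept V u v t) ->
  exists eps, 0 < eps /\ forall s, Rabs (s - t) < eps -> 0 < s < 1 /\ O (ept V u v s).
Proof.
  intros HO Huv Ht Hp. pose proof (adj_neq _ _ Huv) as N.
  assert (Ht0 : 0 <= t <= 1) by lra.
  destruct (HO _ (inG_ept u v t Huv Ht0) Hp) as (Nb & HNb & Hsub).
  destruct HNb as [(u' & v' & t' & a & b & Huv' & Ht' & Eq & Ha & Hb & HN)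
                  |[(w & eps & Eq & _)|(E & S & _ & Eq & _)]].
  - pose proof (adj_neq _ _ Huv') as N'.
    assert (Ht1 : 0 <= t' <= 1) by lra.
    destruct (ept_inj _ _ _ _ _ _ N N' Ht Ht1 Eq) as [(-> & -> & ->)|(-> & -> & ->)].
    + exists (Rmin (t' - a) (b - t')). split. { apply Rmin_pos; lra. }
      intros s Hs. pose proof (Rmin_l (t' - a) (b - t')). pose proof (Rmin_r (t' - a) (b - t')).
      apply Rabs_def2 in Hs. split. { lra. }
      apply Hsub. { apply inG_ept; auto; lra. }
      apply HN. exists s. split; auto; lra.
    + exists (Rmin (t' - a) (b - t')). split. { apply Rmin_pos; lra. }
      intros s Hs. pose proof (Rmin_l (t' - a) (b - t')). pose proof (Rmin_r (t' - a) (b - t')).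
      apply Rabs_def2 in Hs. split. { lra. }
      apply Hsub. { apply inG_ept; auto; lra. }
      apply HN. exists (1 - s). split; auto; try lra. apply ept_swap; auto.
  - exfalso. symmetry in Eq. revert Eq. apply vtx_neq_ept; auto.
  - discriminate Eq.
Qed.

Lemma open_G_vertex O v : open_G V adj O -> O (vtx V v) ->
  exists eps, 0 < eps <= 1 /\ forall u s, adj v u -> 0 <= s < eps -> O (ept V v u s).
Proof.
  intros HO Hp.
  destruct (HO _ (inG_vtx v) Hp) as (Nb & HNb & Hsub).
  destruct HNb as [(u' & v' & t' & a & b & Huv' & Ht' & Eq & _)
                  |[(w & eps & Eq & Heps & HN)|(E & S & _ & Eq & _)]].
  - exfalso. revert Eq. apply vtx_neq_ept; auto. apply adj_neq; auto.
  - apply vtx_inj in Eq. subst w. exists eps. split; auto.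
    intros u s Hu Hs. destruct (Req_dec s 0) as [->|S0].
    { rewrite ept_0; auto. apply adj_neq; auto. }
    apply Hsub. { apply inG_ept; auto; lra. }
    apply HN. right. exists u, s. repeat split; auto; lra.
  - discriminate Eq.
Qed.

Lemma open_G_end O E : open_G V adj O -> is_end V adj E -> O (PEnd V E) ->
  exists S : list V, forall x y s, adj x y -> in_comp V adj S E x -> 0 <= s < 1 -> O (ept V x y s).
Proof.
  intros HO HE Hp.
  destruct (HO (PEnd V E)) as (Nb & HNb & Hsub); auto.
  { right. right. eauto. }
  destruct HNb as [(u' & v' & t' & a & b & Huv' & Ht' & Eq & _)
                  |[(w & eps & Eq & _)|(E' & S & _ & Eq & HN)]]; try discriminate Eq.
  injection Eq as <-. exists S. intros x y s Hxy Hx Hs.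
  apply Hsub. { apply inG_ept; auto; lra. }
  apply HN. left. exists x, y, s. auto.
Qed.

Definition edge_seg (x y : V) (a b : R) (p : point V) : Prop :=
  exists t, a < t < b /\ p = ept V x y t.

(** With [edge_seg] for the same [a] and [b] this leaves out only the two boundary points of the
    segment; the pair serves as a disconnection once those points are gone. *)
Definition off_edge_seg (x y : V) (a b : R) (p : point V) : Prop :=
  ~ exists t, a <= t <= b /\ p = ept V x y t.

Definition star (v : V) (eps : R) (p : point V) : Prop :=
  p = vtx V v \/ exists u s, adj v u /\ 0 < s < eps /\ p = ept V v u s.

Lemma edge_seg_open x y a b : adj x y -> 0 <= a -> b <= 1 -> open_G V adj (edge_seg x y a b).
Proof.
  intros Hxy Ha Hb p _ (t & Ht & ->). exists (edge_seg x y a b). split; auto.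
  left. exists x, y, t, a, b. repeat split; auto; try lra.
Qed.

Lemma star_open v eps : 0 < eps <= 1 -> open_G V adj (star v eps).
Proof.
  intros He p _ [->|(u & s & Hu & Hs & ->)].
  - exists (star v eps). split; auto. right. left. exists v, eps. repeat split; auto; try lra.
  - exists (edge_seg v u 0 eps). split.
    + left. exists v, u, s, 0, eps. repeat split; auto; try lra.
    + intros q _ (t & Ht & ->). right. exists u, t. auto.
Qed.

Lemma off_edge_seg_open x y a b : adj x y -> 0 < a -> b < 1 -> open_G V adj (off_edge_seg x y a b).
Proof.
  intros Hxy Ha Hb p Hp Hoff. pose proof (adj_neq _ _ Hxy) as N.
  destruct (inG_cases _ Hp) as [(v & ->)|[(u & v & t & Huv & Ht & ->)|(E & HE & ->)]].
  - exists (star v (Rmin (1/2) (Rmin a (1 - b)))).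
    pose proof (Rmin_l (1/2) (Rmin a (1 - b))). pose proof (Rmin_r (1/2) (Rmin a (1 - b))).
    pose proof (Rmin_l a (1 - b)). pose proof (Rmin_r a (1 - b)).
    assert (0 < Rmin (1/2) (Rmin a (1 - b))) by (repeat apply Rmin_pos; lra).
    split. { right. left. exists v, (Rmin (1/2) (Rmin a (1 - b))). repeat split; auto; lra. }
    intros q _ [->|(u & s & Hu & Hs & ->)]; auto.
    intros (t & Ht & Eq).
    apply ept_inj in Eq; auto using adj_neq; try lra;
    destruct Eq as [(-> & -> & ->)|(-> & -> & ->)]; lra.
  - pose proof (adj_neq _ _ Huv) as N'.
    assert (Hsame : forall t, 0 < t < 1 -> off_edge_seg x y a b (ept V x y t) -> 
      exists Nb, basic_nbhd V adj (ept V x y t) Nb /\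
        forall q, inG V adj q -> Nb q -> off_edge_seg x y a b q).
    { clear - Hxy Ha Hb N adj_irrefl. intros t Ht Hoff.
      assert (Hor : t < a \/ b < t).
      { destruct (Rlt_dec t a); auto. destruct (Rlt_dec b t); auto.
        exfalso. apply Hoff. exists t. split; auto; lra. }
      destruct Hor.
      + exists (edge_seg x y 0 (Rmin a 1)).
        assert (t < Rmin a 1) by (apply Rmin_glb_lt; lra).
        pose proof (Rmin_l a 1). pose proof (Rmin_r a 1). split.
        { left. exists x, y, t, 0, (Rmin a 1). repeat split; auto; try lra. }
        intros q _ (s & Hs & ->) (s' & Hs' & Eq).
        apply ept_inj in Eq; auto; try lra;
        destruct Eq as [(_ & _ & ->)|(-> & _ & _)]; try lra; auto.
      + exists (edge_seg x y (Rmax b 0) 1).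
        assert (Rmax b 0 < t) by (apply Rmax_lub_lt; lra).
        pose proof (Rmax_l b 0). pose proof (Rmax_r b 0). split.
        { left. exists x, y, t, (Rmax b 0), 1. repeat split; auto; try lra. }
        intros q _ (s & Hs & ->) (s' & Hs' & Eq).
        apply ept_inj in Eq; auto; try lra.
        destruct Eq as [(_ & _ & ->)|(-> & _ & _)]; try lra; auto. }
    destruct (excluded_middle_informative (u = x /\ v = y)) as [[-> ->]|D1]; auto.
    destruct (excluded_middle_informative (u = y /\ v = x)) as [[-> ->]|D2].
    { rewrite ept_swap in * by auto. apply Hsame; auto; lra. }
    exists (edge_seg u v 0 1). split.
    { left. exists u, v, t, 0, 1. repeat split; auto; try lra. }
    intros q _ (s & Hs & ->) (s' & Hs' & Eq).
    apply ept_inj in Eq; auto; try lra;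
    destruct Eq as [(-> & -> & _)|(-> & -> & _)]; auto.
  (* Deleting both end vertices of the edge suffices: an edge issuing from a vertex outside [[x; y]]
     is not the edge [x y]. *)
  - exists (fun q => (exists u v s, adj u v /\ in_comp V adj [x; y] E u /\ 0 <= s < 1 /\ q = ept V u v s) \/
        (exists E', is_end V adj E' /\ q = PEnd V E' /\
           exists r, E' r /\ exists N : nat, forall i, (N <= i)%nat -> in_comp V adj [x; y] E (r i))).
    split. { right. right. exists E, [x; y]. repeat split; auto. }
    intros q _ [(u & v & s & Huv & (r & _ & M & HM) & Hs & ->)|(E' & _ & -> & _)];
      intros (t & Ht & Eq); [|discriminate Eq].
    assert (Hu : ~ In u [x; y]).
    { specialize (HM M (le_n _)). inversion HM; auto. }
    symmetry in Eq.
    apply ept_inj in Eq; auto using adj_neq; try lra.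
    destruct Eq as [(-> & -> & ->)|(-> & -> & ->)]; simpl in Hu; tauto.
Qed.

End GraphSpace.

(** * Sides of a cut *)

Section Cuts.
Variable V : Type.
Variable adj : V -> V -> Prop.
Hypothesis adj_sym : forall u v, adj u v -> adj v u.
Hypothesis adj_irrefl : forall v, ~ adj v v.

Lemma reach_r A u v : reach V adj A u v -> A v.
Proof. induction 1; auto. Qed.

Lemma reach_trans A u v w : reach V adj A u v -> reach V adj A v w -> reach V adj A u w.
Proof.
  intros H1 H2. induction H2 as [|v w x _ IH Hwx Hx]; auto.
  exact (reach_step _ _ _ _ _ _ (IH H1) Hwx Hx).
Qed.

Lemma reach_adj (A : V -> Prop) u v : A u -> A v -> adj u v -> reach V adj A u v.
Proof. intros. eapply reach_step; eauto. apply reach_refl; auto. Qed.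

Lemma reach_sym A u v : reach V adj A u v -> reach V adj A v u.
Proof.
  induction 1. { apply reach_refl; auto. }
  apply reach_trans with v; auto. apply reach_adj; auto. eapply reach_r; eauto.
Qed.

Lemma reach_invariant (A P : V -> Prop) u v :
  (forall x y, A x -> A y -> adj x y -> P x -> P y) -> reach V adj A u v -> P u -> P v.
Proof.
  intros Hs H. induction H; auto. intro. eapply Hs; [| |eauto|]; auto. eapply reach_r; eauto.
Qed.

Lemma injective_leaves_list (r : nat -> V) (l : list V) :
  (forall n m, r n = r m -> n = m) -> exists N, forall n, (N <= n)%nat -> ~ In (r n) l.
Proof.
  intro Hr. induction l as [|x l [N HN]]. { exists 0%nat. auto. }
  destruct (excluded_middle_informative (exists n, r n = x)) as [[n0 Hn0]|Hx].
  - exists (Nat.max N (S n0)). intros n Hn [Hx|Hin].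
    + rewrite Hx in Hn0. apply Hr in Hn0. lia.
    + apply (HN n); auto; lia.
  - exists N. intros n Hn [Hn'|Hin]; [apply Hx; eauto|]. apply (HN n); auto.
Qed.

Lemma ray_tail_reach r S : is_ray V adj r ->
  exists N, forall i j, (N <= i)%nat -> (N <= j)%nat -> reach V adj (avoid V S) (r i) (r j).
Proof.
  intros [Hinj Hadj]. destruct (injective_leaves_list r S Hinj) as [N HN].
  exists N.
  assert (H : forall i d, (N <= i)%nat -> reach V adj (avoid V S) (r i) (r (i + d)%nat)).
  { intros i d Hi. induction d.
    - rewrite Nat.add_0_r. apply reach_refl. exact (HN i Hi).
    - rewrite Nat.add_succ_r. eapply reach_step; eauto. apply HN. lia. }
  intros i j Hi Hj. destruct (le_lt_dec i j).
  - replace j with (i + (j - i))%nat by lia. auto.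
  - apply reach_sym. replace i with (j + (i - j))%nat by lia. auto.
Qed.

Lemma end_reach E r r' S : is_end V adj E -> E r -> E r' ->
  exists N, forall i j, (N <= i)%nat -> (N <= j)%nat -> reach V adj (avoid V S) (r i) (r' j).
Proof.
  intros (r0 & Hr0 & HE) Hr Hr'.
  apply HE in Hr. apply HE in Hr'. destruct Hr as [_ Hr]. destruct Hr' as [_ Hr'].
  destruct (Hr S) as [N HN]. destruct (Hr' S) as [N' HN'].
  exists (Nat.max N N'). intros i j Hi Hj.
  apply reach_trans with (r0 (Nat.max N N')).
  - apply reach_sym. apply HN; lia.
  - apply HN'; lia.
Qed.

Lemma end_inhabited E : is_end V adj E -> exists r, is_ray V adj r /\ E r.
Proof.
  intros (r0 & Hr0 & HE). exists r0. split; auto. apply HE. split; auto.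
  intro S. apply ray_tail_reach; auto.
Qed.

(** A late vertex of [r] is joined outside [S] to tails of rays of both ends. Hence a separator that
    witnesses something for [E] also works for every end in the corresponding neighbourhood. *)
Lemma in_comp_of_tail S E E' r N x : is_end V adj E' -> E' r ->
  (forall i, (N <= i)%nat -> in_comp V adj S E (r i)) ->
  in_comp V adj S E' x -> in_comp V adj S E x.
Proof.
  intros HE' Hr Htail (r' & Hr' & M & HM).
  destruct (end_reach _ _ _ S HE' Hr Hr') as [L HL].
  set (n := Nat.max N (Nat.max M L)).
  destruct (Htail n) as (rho & Hrho & K & HK). { lia. }
  exists rho. split; auto. exists K. intros i Hi.
  apply reach_trans with (r n); auto.
  apply reach_trans with (r' n). { apply HL; lia. } apply HM; lia.
Qed.

(* The points on the X-side of the cut (X, V \ X), every cut edge being split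
   at its midpoint; an end lies on the X-side when finitely many vertices separate
   it from V \ X. *)
Definition cut_side (X : V -> Prop) (p : point V) : Prop :=
  (exists v, X v /\ p = vtx V v) \/
  (exists u v t, adj u v /\ 0 < t < 1 /\ p = ept V u v t /\ X u /\ (t < 1/2 \/ X v)) \/
  (exists E S, is_end V adj E /\ p = PEnd V E /\
     forall x y, in_comp V adj S E x -> adj x y -> X x /\ X y).

(** The neighbourhood of an end contains the half-open edges leading to [S]. This is why [cut_side]
    requires the neighbours of the component, and not only its vertices, to lie in [X]. *)
Lemma cut_side_open X : open_G V adj (cut_side X).
Proof.
  intros p _ [(v & Hv & ->)|[(u & v & t & Huv & Ht & -> & Hu & Hor)|(E & S & HE & -> & HS)]].
  - exists (star V adj v (1/2)). split.
    { right. left. exists v, (1/2). repeat split; auto; lra. }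
    intros q _ [->|(u & s & Hu & Hs & ->)]. { left; eauto. }
    right. left. exists v, u, s. repeat split; auto; lra.
  - destruct (excluded_middle_informative (X v)) as [Hv|Hv].
    + exists (edge_seg V u v 0 1). split.
      { left. exists u, v, t, 0, 1. repeat split; auto; lra. }
      intros q _ (s & Hs & ->). right. left. exists u, v, s. auto 10.
    + exists (edge_seg V u v 0 (1/2)). destruct Hor; [|tauto]. split.
      { left. exists u, v, t, 0, (1/2). repeat split; auto; lra. }
      intros q _ (s & Hs & ->). right. left. exists u, v, s.
      repeat split; auto; lra.
  - eexists. split.
    { right. right. exists E, S. split; auto. split; auto. intro q. apply iff_refl. }
    intros q _ [(x & y & s & Hxy & Hx & Hs & ->)|(E' & HE' & -> & r & Hr & N & HN)].
    + destruct (HS _ _ Hx Hxy) as [Xx Xy]. destruct (Req_dec s 0) as [->|].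
      * left. exists x. split; auto. apply ept_0. eapply adj_neq; eauto.
      * right. left. exists x, y, s. repeat split; auto; lra.
    + right. right. exists E', S. split; auto. split; auto.
      intros x y Hx Hxy. apply HS; auto. eapply in_comp_of_tail; eauto.
Qed.

Lemma cut_side_vtx X v : cut_side X (vtx V v) <-> X v.
Proof.
  split.
  - intros [(u & Hu & Eq)|[(a & b & t & Hab & Ht & Eq & _)|(E & S & _ & Eq & _)]].
    + apply vtx_inj in Eq. congruence.
    + exfalso. revert Eq. apply vtx_neq_ept; auto. eapply adj_neq; eauto.
    + discriminate Eq.
  - left; eauto.
Qed.

Lemma cut_side_interior X u v t : adj u v -> 0 < t < 1 -> cut_side X (ept V u v t) ->
  X u /\ X v \/ X u /\ t < 1/2 \/ X v /\ t > 1/2.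
Proof.
  intros Huv Ht H. pose proof (adj_neq _ _ adj_irrefl _ _ Huv) as N.
  destruct H as [(w & _ & Eq)|[(a & b & s & Hab & Hs & Eq & Ha & Hor)|(E & S & _ & Eq & _)]].
  - exfalso. symmetry in Eq. revert Eq. apply vtx_neq_ept; auto.
  - pose proof (adj_neq _ _ adj_irrefl _ _ Hab) as N'.
    apply ept_inj in Eq; auto; [|lra].
    destruct Eq as [(-> & -> & ->)|(-> & -> & ->)]; destruct Hor; auto.
    right. right. split; auto; lra.
  - discriminate Eq.
Qed.

Lemma cut_side_ept X u v t : adj u v -> 0 <= t <= 1 -> cut_side X (ept V u v t) -> X u \/ X v.
Proof.
  intros Huv Ht H. pose proof (adj_neq _ _ adj_irrefl _ _ Huv) as N.
  destruct (Req_dec t 0) as [->|]. { rewrite ept_0 in H by auto. apply cut_side_vtx in H. auto. }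
  destruct (Req_dec t 1) as [->|]. { rewrite ept_1 in H by auto. apply cut_side_vtx in H. auto. }
  apply cut_side_interior in H; auto; try lra. tauto.
Qed.

(** For an end, the two sides come with different separators [S] and [S']; a late vertex of one ray
    of the end lies beyond both and would be inside and outside [X]. *)
Lemma cut_side_disjoint X p : cut_side X p -> cut_side (fun v => ~ X v) p -> False.
Proof.
  intros H1 H2. destruct H1 as [(v & Hv & ->)|[(u & v & t & Huv & Ht & -> & Hu & Hor)|(E & S & HE & -> & HS)]].
  - apply cut_side_vtx in H2. auto.
  - apply cut_side_interior in H2; auto.
    destruct H2 as [H2|[H2|[H2 H3]]]; try tauto. destruct Hor; [lra|tauto].
  - destruct H2 as [(v & _ & Eq)|[(u & v & t & Huv & Ht & Eq & _)|(E' & S' & _ & Eq & HS')]];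
      try discriminate Eq.
    injection Eq as <-.
    destruct (end_inhabited E HE) as (r & Hray & Hr).
    destruct (ray_tail_reach r S Hray) as [N HN].
    destruct (ray_tail_reach r S' Hray) as [N' HN'].
    set (n := Nat.max N N').
    destruct (HS (r n) (r (n + 1)%nat)) as [Xn _].
    { exists r. split; auto. exists N. intros i Hi. apply HN; lia. }
    { rewrite Nat.add_1_r. apply Hray. }
    destruct (HS' (r n) (r (n + 1)%nat)) as [Xn' _]; auto.
    { exists r. split; auto. exists N'. intros i Hi. apply HN'; lia. }
    { rewrite Nat.add_1_r. apply Hray. }
Qed.

Lemma cut_side_cover X p : inG V adj p ->
  (forall E, p = PEnd V E -> cut_side X p \/ cut_side (fun v => ~ X v) p) ->
  cut_side X p \/ cut_side (fun v => ~ X v) p \/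
  exists u v, adj u v /\ X u /\ ~ X v /\ p = ept V u v (1/2).
Proof.
  intros Hp Hend.
  destruct (inG_cases _ _ adj_irrefl _ Hp) as [(v & ->)|[(u & v & t & Huv & Ht & ->)|(E & HE & ->)]].
  - rewrite !cut_side_vtx. tauto.
  - pose proof (adj_neq _ _ adj_irrefl _ _ Huv) as N.
    destruct (excluded_middle_informative (X u)) as [Xu|Xu];
    destruct (excluded_middle_informative (X v)) as [Xv|Xv].
    + left. right. left. exists u, v, t. auto 10.
    + destruct (Rtotal_order t (1/2)) as [Hlt|[->|Hgt]].
      * left. right. left. exists u, v, t. auto 10.
      * right. right. exists u, v. auto.
      * right. left. right. left. exists v, u, (1 - t). repeat split; auto; try lra.
        apply ept_swap; auto.
    + destruct (Rtotal_order t (1/2)) as [Hlt|[->|Hgt]].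
      * right. left. right. left. exists u, v, t. auto 10.
      * right. right. exists v, u. repeat split; auto.
        rewrite ept_swap by auto. f_equal. lra.
      * left. right. left. exists v, u, (1 - t). repeat split; auto; try lra.
        apply ept_swap; auto.
    + right. left. right. left. exists u, v, t. auto 10.
  - destruct (Hend E eq_refl); auto.
Qed.

End Cuts.

(** * Circles minus a point *)

Lemma dist2_lt z z' eps : 0 < eps ->
  (dist2 z z' < eps <-> (fst z - fst z')^2 + (snd z - snd z')^2 < eps^2).
Proof.
  intro He. unfold dist2.
  set (q := (fst z - fst z')^2 + (snd z - snd z')^2).
  assert (Hq : 0 <= q) by (unfold q; apply Rplus_le_le_0_compat; apply pow2_ge_0).
  assert (Heq : sqrt (eps^2) = eps) by (apply sqrt_pow2; lra).
  split; intro H.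
  - apply sqrt_lt_0_alt. rewrite Heq. exact H.
  - rewrite <- Heq. apply sqrt_lt_1_alt. lra.
Qed.

(* Inverse of the stereographic projection of the unit circle from z0. *)
Definition stereo (z0 : R * R) (s : R) : R * R :=
  (fst z0 * ((s^2 - 1) / (s^2 + 1)) - snd z0 * (2 * s / (s^2 + 1)),
   snd z0 * ((s^2 - 1) / (s^2 + 1)) + fst z0 * (2 * s / (s^2 + 1))).

Lemma stereo_S1 z0 s : S1 z0 -> S1 (stereo z0 s).
Proof.
  unfold S1, stereo. simpl fst. simpl snd. intro H.
  assert (s^2 + 1 <> 0) by nra.
  transitivity ((fst z0 ^ 2 + snd z0 ^ 2) * 1); [field; repeat split; nra | rewrite H; ring].
Qed.

Lemma stereo_sqdist z0 s s' : S1 z0 ->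
  (fst (stereo z0 s) - fst (stereo z0 s'))^2 + (snd (stereo z0 s) - snd (stereo z0 s'))^2
  = 4 * (s - s')^2 / ((s^2 + 1) * (s'^2 + 1)).
Proof.
  unfold S1, stereo. simpl fst. simpl snd. intro H.
  assert (s^2 + 1 <> 0) by nra. assert (s'^2 + 1 <> 0) by nra.
  transitivity ((fst z0 ^ 2 + snd z0 ^ 2) * (4 * (s - s')^2 / ((s^2 + 1) * (s'^2 + 1))));
    [field; repeat split; nra | rewrite H; ring].
Qed.

Lemma stereo_sqdist_pole z0 s : S1 z0 ->
  (fst z0 - fst (stereo z0 s))^2 + (snd z0 - snd (stereo z0 s))^2 = 4 / (s^2 + 1).
Proof.
  unfold S1, stereo. simpl fst. simpl snd. intro H.
  assert (s^2 + 1 <> 0) by nra.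
  transitivity ((fst z0 ^ 2 + snd z0 ^ 2) * (4 / (s^2 + 1))); [field; repeat split; nra | rewrite H; ring].
Qed.

Lemma stereo_surj z0 z : S1 z0 -> S1 z -> z <> z0 -> exists s, stereo z0 s = z.
Proof.
  destruct z0 as [a b], z as [x y]. unfold S1, stereo. simpl fst; simpl snd. intros H0 H Hne.
  (* [d] and [c] are the coordinates of [z] in the orthonormal frame given by [z0] and its rotation
     by a right angle. Solving for the parameter gives c / (1 - d). *)
  set (d := a * x + b * y). set (c := a * y - b * x).
  assert (Hdc : d^2 + c^2 = 1).
  { transitivity ((a^2 + b^2) * (x^2 + y^2)); [unfold d, c; ring | rewrite H0, H; ring]. }
  assert (Hd : d <> 1).
  { intro Hd. apply Hne. assert (D : Rsqr (x - a) + Rsqr (y - b) = 0).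
    { transitivity ((a^2 + b^2) + (x^2 + y^2) - 2 * d);
        [unfold d, Rsqr; ring | rewrite H0, H, Hd; ring]. }
    destruct (Rplus_sqr_eq_0 _ _ D). f_equal; lra. }
  assert (Hd1 : 1 - d <> 0) by lra.
  assert (Hs : (c / (1 - d))^2 + 1 = 2 / (1 - d)).
  { transitivity ((c^2 + (1 - d)^2) / (1 - d)^2); [field; auto|].
    replace (c^2) with (1 - d^2) by lra. field; auto. }
  exists (c / (1 - d)).
  assert (E1 : ((c / (1 - d))^2 - 1) / ((c / (1 - d))^2 + 1) = d).
  { replace ((c / (1 - d))^2 - 1) with (2 / (1 - d) - 2) by lra. rewrite Hs. field; auto. }
  assert (E2 : 2 * (c / (1 - d)) / ((c / (1 - d))^2 + 1) = c).
  { rewrite Hs. field; auto. }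
  rewrite E1, E2. f_equal.
  - transitivity ((a^2 + b^2) * x); [unfold d, c; ring | rewrite H0; ring].
  - transitivity ((a^2 + b^2) * y); [unfold d, c; ring | rewrite H0; ring].
Qed.

Lemma stereo_inj z0 s s' : S1 z0 -> stereo z0 s = stereo z0 s' -> s = s'.
Proof.
  intros H E. pose proof (stereo_sqdist z0 s s' H) as D. rewrite E in D.
  assert (0 < (s^2 + 1) * (s'^2 + 1)) by (apply Rmult_lt_0_compat; nra).
  assert (D' : 4 * (s - s')^2 = 0).
  { transitivity (4 * (s - s')^2 / ((s^2 + 1) * (s'^2 + 1)) * ((s^2 + 1) * (s'^2 + 1))).
    - field. split; nra.
    - rewrite <- D. ring. }
  nra.
Qed.

Lemma stereo_neq_pole z0 s : S1 z0 -> stereo z0 s <> z0.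
Proof.
  intros H E. pose proof (stereo_sqdist_pole z0 s H) as D. rewrite E in D.
  assert (0 < 4 / (s^2 + 1)) by (apply Rdiv_lt_0_compat; nra). nra.
Qed.

Lemma stereo_inverse_continuous z0 s0 delta : S1 z0 -> 0 < delta ->
  exists eps, 0 < eps /\ forall s, dist2 (stereo z0 s0) (stereo z0 s) < eps -> Rabs (s - s0) < delta.
Proof.
  intros H Hd.
  set (M := s0^2 + 1). assert (HM : 1 <= M) by (unfold M; nra).
  assert (HM2 : 1 <= M * M) by nra.
  (* The bound 1 / M makes the term with [u] on the right of [K2] at most 2u, so that it is absorbed
     by the left side 4u; the bound delta / M then controls what remains. *)
  set (e := Rmin (1 / M) (delta / M)).
  assert (He : 0 < e) by (apply Rmin_pos; apply Rdiv_lt_0_compat; lra).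
  exists e. split; auto. intros s Hs. apply dist2_lt in Hs; auto.
  rewrite stereo_sqdist in Hs by auto. fold M in Hs.
  assert (He1 : e * M <= 1).
  { pose proof (Rmin_l (1 / M) (delta / M)). fold e in H0.
    replace 1 with (1 / M * M) by (field; lra). apply Rmult_le_compat_r; lra. }
  assert (He2 : e * M <= delta).
  { pose proof (Rmin_r (1 / M) (delta / M)). fold e in H0.
    replace delta with (delta / M * M) by (field; lra). apply Rmult_le_compat_r; lra. }
  set (u := (s - s0)^2).
  assert (Hu : 4 * u < e^2 * (M * (s^2 + 1))).
  { assert (P : 0 < M * (s^2 + 1)) by (apply Rmult_lt_0_compat; nra).
    apply Rmult_lt_compat_r with (r := M * (s^2 + 1)) in Hs; auto.
    replace (4 * (s0 - s)^2 / (M * (s^2 + 1)) * (M * (s^2 + 1))) with (4 * u) in Hs.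
    exact Hs. unfold u. field. split; nra. }
  assert (Hs2 : s^2 + 1 <= 2 * M + 2 * u) by (unfold M, u; pose proof (pow2_ge_0 (s - 2 * s0)); lra).
  assert (0 <= u) by (unfold u; apply pow2_ge_0).
  assert (K1 : e^2 * (M * (s^2 + 1)) <= e^2 * (M * (2 * M + 2 * u))).
  { apply Rmult_le_compat_l; [nra|]. apply Rmult_le_compat_l; lra. }
  assert (K2 : e^2 * (M * (2 * M + 2 * u)) = 2 * (e*M)^2 + 2 * u * ((e * M) * e)) by ring.
  assert (K3 : e <= 1) by nra.
  assert (K4 : 0 < e * M) by nra.
  assert (K5 : (e * M) * e <= 1) by nra.
  assert (K6 : 2 * u * ((e * M) * e) <= 2 * u) by nra.
  assert (K7 : u < (e * M)^2) by lra.
  assert (K8 : u < delta^2) by nra.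
  unfold u in K8. apply Rabs_def1; nra.
Qed.

(** Supremum argument: the largest initial segment contained in [A] can neither stop at a point of
    [B] nor stop before [b]. *)
Lemma interval_connected (A B : R -> Prop) a b :
  (forall x, a <= x <= b -> A x \/ B x) ->
  (forall x, a <= x <= b -> A x -> B x -> False) ->
  (forall x, a <= x <= b -> A x -> exists eps, 0 < eps /\ forall y, Rabs (y - x) < eps -> A y) ->
  (forall x, a <= x <= b -> B x -> exists eps, 0 < eps /\ forall y, Rabs (y - x) < eps -> B y) ->
  a <= b -> A a -> A b.
Proof.
  intros Hcov Hdis HA HB Hab Ha.
  set (E := fun x => a <= x <= b /\ forall y, a <= y <= x -> A y).
  destruct (completeness E) as [c [Hub Hlub]].
  { exists b. intros x [Hx _]. lra. }
  { exists a. split. lra. intros y Hy. replace y with a by lra. auto. }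
  assert (Hac : a <= c).
  { apply Hub. split. lra. intros y Hy. replace y with a by lra. auto. }
  assert (Hcb : c <= b). { apply Hlub. intros x [Hx _]. lra. }
  assert (Hbelow : forall y, a <= y < c -> A y).
  { intros y Hy. destruct (excluded_middle_informative (A y)) as [|N]; auto. exfalso.
    assert (c <= y); [|lra]. apply Hlub. intros x [Hx Hx'].
    destruct (Rle_dec x y); auto. exfalso. apply N. apply Hx'. lra. }
  assert (Hc : A c).
  { destruct (Hcov c (conj Hac Hcb)) as [|Bc]; auto. exfalso.
    destruct (HB c (conj Hac Hcb) Bc) as (eps & He & HBe).
    destruct (Req_dec a c) as [->|Nac]. { apply (Hdis c); auto; lra. }
    set (y := Rmax a (c - eps / 2)).
    assert (a <= y) by apply Rmax_l. assert (c - eps / 2 <= y) by apply Rmax_r.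
    assert (y < c) by (apply Rmax_lub_lt; lra).
    apply (Hdis y). lra. apply Hbelow; lra. apply HBe. apply Rabs_def1; lra. }
  destruct (Req_dec c b) as [<-|Ncb]; auto. exfalso.
  destruct (HA c (conj Hac Hcb) Hc) as (eps & He & HAe).
  set (d := Rmin b (c + eps / 2)).
  assert (d <= b) by apply Rmin_l. assert (d <= c + eps / 2) by apply Rmin_r.
  assert (c < d) by (apply Rmin_glb_lt; lra).
  assert (d <= c); [|lra]. apply Hub. split. lra.
  intros y Hy. destruct (Rlt_dec y c). { apply Hbelow; lra. }
  apply HAe. apply Rabs_def1; lra.
Qed.

Section Circles.
Variable V : Type.
Variable adj : V -> V -> Prop.
Hypothesis adj_sym : forall u v, adj u v -> adj v u.
Hypothesis adj_irrefl : forall v, ~ adj v v.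

(** The parametrization of the circle composed with [stereo]. The last clause says that [p] takes
    the place of infinity on the line, so that approaching [p] can still be expressed. *)
Lemma circle_minus_point C p : is_circle V adj C -> C p -> exists h : R -> point V,
  (forall s, C (h s) /\ h s <> p) /\
  (forall q, C q -> q <> p -> exists s, h s = q) /\
  (forall s s', h s = h s' -> s = s') /\
  (forall O, open_G V adj O -> forall s, O (h s) ->
     exists eps, 0 < eps /\ forall s', Rabs (s' - s) < eps -> O (h s')) /\
  (forall s0 delta, 0 < delta ->
     exists O, open_G V adj O /\ O (h s0) /\ forall s, O (h s) -> Rabs (s - s0) < delta) /\
  (forall K, exists O, open_G V adj O /\ O p /\ forall s, O (h s) -> K < Rabs s).
Proof.
  intros (_ & f & Hf & Hsurj & Hinj & Hcont & Hinv) Hp.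
  destruct (Hsurj p Hp) as (z0 & Hz0 & <-).
  exists (fun s => f (stereo z0 s)).
  repeat split.
  - apply Hf. apply stereo_S1; auto.
  - intro E. apply (stereo_neq_pole z0 s); auto. apply Hinj; auto. apply stereo_S1; auto.
  - intros q Hq Hqp. destruct (Hsurj q Hq) as (z & Hz & <-).
    destruct (stereo_surj z0 z) as (s & <-); eauto. congruence.
  - intros s s' E. apply (stereo_inj z0); auto. apply Hinj; auto using stereo_S1.
  - intros O HO s Hs. destruct (Hcont O HO (stereo z0 s)) as (eps & He & Hball); auto using stereo_S1.
    exists (eps / 2). split. lra. intros s' Hs'. apply Hball; auto using stereo_S1.
    apply dist2_lt; auto. rewrite stereo_sqdist by auto.
    apply Rabs_def2 in Hs'.
    assert (Hq : (s - s')^2 < (eps / 2)^2) by nra.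
    assert (P : 1 <= (s^2 + 1) * (s'^2 + 1)) by nra.
    apply Rle_lt_trans with (4 * (s - s')^2); [|nra].
    apply Rmult_le_reg_r with ((s^2 + 1) * (s'^2 + 1)); [lra|].
    replace (4 * (s - s') ^ 2 / ((s ^ 2 + 1) * (s' ^ 2 + 1)) * ((s ^ 2 + 1) * (s' ^ 2 + 1)))
      with (4 * (s - s')^2 * 1) by (field; split; nra).
    apply Rmult_le_compat_l; [pose proof (pow2_ge_0 (s - s')); lra | exact P].
  - intros s0 delta Hd. destruct (stereo_inverse_continuous z0 s0 delta) as (eps & He & Hball); auto.
    destruct (Hinv (stereo z0 s0) eps) as (O & HO & HOs & HOb); auto using stereo_S1.
    exists O. split; auto. split; auto. intros s Hs. apply Hball. apply HOb; auto using stereo_S1.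
  - intro K.
    set (e := 2 / (Rabs K + 1)). pose proof (Rabs_pos K).
    assert (He : 0 < e) by (apply Rdiv_lt_0_compat; lra).
    destruct (Hinv z0 e) as (O & HO & HOs & HOb); auto.
    exists O. split; auto. split; auto. intros s Hs.
    specialize (HOb (stereo z0 s) (stereo_S1 z0 s Hz0) Hs).
    apply dist2_lt in HOb; auto. rewrite stereo_sqdist_pole in HOb by auto.
    assert (P : 0 < s^2 + 1) by nra.
    assert (Q : 0 < Rabs K + 1) by lra.
    apply Rmult_lt_compat_r with (r := (s^2 + 1) * (Rabs K + 1)^2) in HOb; [|apply Rmult_lt_0_compat; nra].
    replace (4 / (s^2 + 1) * ((s^2 + 1) * (Rabs K + 1)^2)) with (4 * (Rabs K + 1)^2) in HOb by (field; nra).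
    replace (e^2 * ((s^2 + 1) * (Rabs K + 1)^2)) with (4 * (s^2 + 1)) in HOb by (unfold e; field; nra).
    apply Rle_lt_trans with (Rabs K); [apply Rle_abs|].
    destruct (Rlt_dec (Rabs K) (Rabs s)) as [|N]; auto. exfalso.
    assert (Rabs s * Rabs s = s^2). { rewrite <- Rabs_mult. rewrite Rabs_pos_eq; nra. }
    pose proof (Rabs_pos s). nra.
Qed.

Lemma circle_minus_point_connected C (A B : point V -> Prop) p q1 q2 :
  is_circle V adj C -> C p -> open_G V adj A -> open_G V adj B ->
  (forall q, C q -> q <> p -> A q \/ B q) -> (forall q, C q -> A q -> B q -> False) ->
  C q1 -> q1 <> p -> A q1 -> C q2 -> q2 <> p -> B q2 -> False.
Proof.
  intros HC Hp HA HB Hcov Hdis C1 N1 A1 C2 N2 B2.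
  destruct (circle_minus_point C p HC Hp) as (h & Hh & Hsurj & _ & Hcont & _ & _).
  destruct (Hsurj q1 C1 N1) as (s1 & <-). destruct (Hsurj q2 C2 N2) as (s2 & <-).
  destruct (Rle_dec s1 s2) as [L|L].
  - apply (Hdis (h s2)); auto.
    apply (interval_connected (fun s => A (h s)) (fun s => B (h s)) s1 s2); auto.
    + intros x _. apply Hcov; apply Hh.
    + intros x _. apply Hdis; apply Hh.
  - apply (Hdis (h s1)); auto.
    apply (interval_connected (fun s => B (h s)) (fun s => A (h s)) s2 s1); auto; try lra.
    + intros x _. destruct (Hcov (h x)); auto; apply Hh.
    + intros x _ HBx HAx. apply (Hdis (h x)); auto; apply Hh.
Qed.

(* Three removed points leave three arcs, and the two arcs meeting at a removed point
   lie on different sides: this would 2-colour a triangle. *)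
Lemma circle_three_crossings C (A B : point V -> Prop) p1 p2 p3 :
  is_circle V adj C -> C p1 -> C p2 -> C p3 -> p1 <> p2 -> p1 <> p3 -> p2 <> p3 ->
  open_G V adj A -> open_G V adj B ->
  (forall q, C q -> q <> p1 -> q <> p2 -> q <> p3 -> A q \/ B q) ->
  (forall q, C q -> A q -> B q -> False) ->
  (forall p, p = p1 \/ p = p2 \/ p = p3 -> ~ A p /\ ~ B p /\
     forall O, open_G V adj O -> O p ->
       (exists q, C q /\ O q /\ A q) /\ (exists q, C q /\ O q /\ B q)) ->
  False.
Proof.
  intros HC C1 C2 C3 N12 N13 N23 HA HB Hcov Hdis Hacc.
  destruct (circle_minus_point C p1 HC C1) as (h & Hh & Hsurj & Hinj & Hcont & Hinv & Hinf).
  destruct (Hsurj p2 C2) as (s2 & E2); auto. destruct (Hsurj p3 C3) as (s3 & E3); auto.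
  assert (Hne : s2 <> s3) by congruence.
  assert (HA1 : ~ A p1 /\ ~ B p1) by (destruct (Hacc p1) as (? & ? & _); auto).
  assert (HA2 : ~ A p2 /\ ~ B p2) by (destruct (Hacc p2) as (? & ? & _); auto).
  assert (HA3 : ~ A p3 /\ ~ B p3) by (destruct (Hacc p3) as (? & ? & _); auto).
  assert (pt : forall q, C q -> A q \/ B q -> exists s, h s = q).
  { intros q Cq Hq. apply Hsurj; auto. intros ->; tauto. }
  (* No change of colour on an interval that avoids both removed parameters. *)
  assert (mono : forall s t lo hi, lo <= s <= hi -> lo <= t <= hi ->
     ~ (lo <= s2 <= hi) -> ~ (lo <= s3 <= hi) -> A (h s) -> B (h t) -> False).
  { assert (Hcov' : forall x, x <> s2 -> x <> s3 -> A (h x) \/ B (h x)).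
    { intros x X2 X3. apply Hcov; try apply Hh; intro Eq.
      - apply X2. apply Hinj. congruence.
      - apply X3. apply Hinj. congruence. }
    intros s t lo hi Hs Ht H2 H3 As Bt. destruct (Rle_dec s t) as [L|L].
    - apply (Hdis (h t)); auto. { apply Hh. }
      apply (interval_connected (fun s => A (h s)) (fun s => B (h s)) s t); auto.
      + intros x Hx. apply Hcov'; intros ->; lra.
      + intros x _. apply Hdis; apply Hh.
    - apply (Hdis (h s)); auto. { apply Hh. }
      apply (interval_connected (fun s => B (h s)) (fun s => A (h s)) t s); auto; try lra.
      + intros x Hx. destruct (Hcov' x); auto; intros ->; lra.
      + intros x _ HBx HAx. apply (Hdis (h x)); auto; apply Hh. }
  (* Near [p1] means near infinity on the line, so both colours occur on the two unbounded arcs. *)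
  assert (near1 : exists a b, A (h a) /\ B (h b) /\
     Rabs s2 + Rabs s3 < Rabs a /\ Rabs s2 + Rabs s3 < Rabs b).
  { destruct (Hinf (Rabs s2 + Rabs s3)) as (O & HO & Op & HOs).
    destruct (Hacc p1) as (_ & _ & Hb); auto.
    destruct (Hb O HO Op) as [(q & Cq & Oq & Aq) (q' & Cq' & Oq' & Bq')].
    destruct (pt q) as (a & <-); auto. destruct (pt q') as (b & <-); auto.
    exists a, b. auto. }
  assert (near : forall p s0 delta, p = p2 \/ p = p3 -> h s0 = p -> 0 < delta ->
     exists a b, A (h a) /\ B (h b) /\
       s0 - delta < a < s0 + delta /\ s0 - delta < b < s0 + delta /\ a <> s0 /\ b <> s0).
  { intros p s0 delta Hp Eh Hd. destruct (Hinv s0 delta Hd) as (O & HO & Op & HOs).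
    destruct (Hacc p) as (NA & NB & Hb). { tauto. }
    destruct (Hb O HO) as [(q & Cq & Oq & Aq) (q' & Cq' & Oq' & Bq')]. { congruence. }
    destruct (pt q) as (a & <-); auto. destruct (pt q') as (b & <-); auto.
    exists a, b. apply HOs, Rabs_def2 in Oq. apply HOs, Rabs_def2 in Oq'.
    repeat split; auto; try lra; intros ->; congruence. }
  (* The colouring argument with the removed parameters named by order, so that it serves both
     [s2 < s3] and [s3 < s2]. *)
  assert (key : forall lo hi, lo < hi ->
     (forall s t a b, a <= s <= b -> a <= t <= b ->
        ~ (a <= lo <= b) -> ~ (a <= hi <= b) -> A (h s) -> B (h t) -> False) ->
     (exists a b, A (h a) /\ B (h b) /\ (a < lo \/ hi < a) /\ (b < lo \/ hi < b)) ->
     (exists a b, A (h a) /\ B (h b) /\ a < hi /\ b < hi /\ a <> lo /\ b <> lo) ->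
     (exists a b, A (h a) /\ B (h b) /\ lo < a /\ lo < b /\ a <> hi /\ b <> hi) -> False).
  { clear. intros lo hi Hlt mono (a1 & b1 & A1 & B1 & Ha1 & Hb1)
      (a2 & b2 & A2 & B2 & Ha2 & Hb2 & Na2 & Nb2) (a3 & b3 & A3 & B3 & Ha3 & Hb3 & Na3 & Nb3).
    assert (arcL : forall s t, s < lo -> t < lo -> A (h s) -> B (h t) -> False).
    { intros s t Hs Ht. apply (mono s t (Rmin s t) (Rmax s t));
        pose proof (Rmin_l s t); pose proof (Rmin_r s t); pose proof (Rmax_l s t);
        pose proof (Rmax_r s t); pose proof (Rmax_lub_lt s t lo); lra. }
    assert (arcM : forall s t, lo < s < hi -> lo < t < hi -> A (h s) -> B (h t) -> False).
    { intros s t Hs Ht. apply (mono s t (Rmin s t) (Rmax s t));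
        pose proof (Rmin_l s t); pose proof (Rmin_r s t); pose proof (Rmax_l s t);
        pose proof (Rmax_r s t); pose proof (Rmax_lub_lt s t hi); pose proof (Rmin_glb_lt s t lo); lra. }
    assert (arcR : forall s t, hi < s -> hi < t -> A (h s) -> B (h t) -> False).
    { intros s t Hs Ht. apply (mono s t (Rmin s t) (Rmax s t));
        pose proof (Rmin_l s t); pose proof (Rmin_r s t); pose proof (Rmax_l s t);
        pose proof (Rmax_r s t); pose proof (Rmin_glb_lt s t hi); lra. }
    (* Both colours on one outer arc contradict [arcL] or [arcR]. Otherwise the outer arcs have
       different colours, and the middle arc would have to differ from both. *)
    destruct Ha1 as [Ha1|Ha1], Hb1 as [Hb1|Hb1]; eauto.
    - assert (lo < b2). { destruct (Rlt_dec b2 lo); [exfalso; eauto|lra]. }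
      assert (a3 < hi). { destruct (Rlt_dec hi a3); [exfalso; eauto|lra]. }
      apply (arcM a3 b2); auto.
    - assert (lo < a2). { destruct (Rlt_dec a2 lo); [exfalso; eauto|lra]. }
      assert (b3 < hi). { destruct (Rlt_dec hi b3); [exfalso; eauto|lra]. }
      apply (arcM a2 b3); auto. }
  destruct near1 as (a1 & b1 & A1 & B1 & Ra1 & Rb1).
  assert (far : forall x, Rabs s2 + Rabs s3 < Rabs x -> (x < s2 /\ x < s3) \/ (s2 < x /\ s3 < x)).
  { intros x. unfold Rabs. destruct (Rcase_abs s2), (Rcase_abs s3), (Rcase_abs x); intros; lra. }
  apply far in Ra1. apply far in Rb1.
  destruct (Rlt_dec s2 s3) as [L|L].
  - destruct (near p2 s2 (s3 - s2)) as (a2 & b2 & A2 & B2 & Ra2 & Rb2 & Na2 & Nb2); auto; try lra.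
    destruct (near p3 s3 (s3 - s2)) as (a3 & b3 & A3 & B3 & Ra3 & Rb3 & Na3 & Nb3); auto; try lra.
    apply (key s2 s3 L mono).
    + exists a1, b1. repeat split; auto; lra.
    + exists a2, b2. repeat split; auto; lra.
    + exists a3, b3. repeat split; auto; lra.
  - destruct (near p2 s2 (s2 - s3)) as (a2 & b2 & A2 & B2 & Ra2 & Rb2 & Na2 & Nb2); auto; try lra.
    destruct (near p3 s3 (s2 - s3)) as (a3 & b3 & A3 & B3 & Ra3 & Rb3 & Na3 & Nb3); auto; try lra.
    assert (L' : s3 < s2) by lra.
    apply (key s3 s2 L'); eauto.
    + exists a1, b1. repeat split; auto; lra.
    + exists a3, b3. repeat split; auto; lra.
    + exists a2, b2. repeat split; auto; lra.
Qed.

End Circles.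

(** * Cuts and Hamilton circles *)

Section HamiltonCuts.
Variable V : Type.
Variable adj : V -> V -> Prop.
Hypothesis adj_sym : forall u v, adj u v -> adj v u.
Hypothesis adj_irrefl : forall v, ~ adj v v.
Hypothesis V_infinite : infinite_graph V.
Variable C : point V -> Prop.
Hypothesis C_hamilton : hamilton_circle V adj C.

Let C_circle : is_circle V adj C := proj1 C_hamilton.
Let C_vtx : forall v, C (vtx V v) := proj2 C_hamilton.
Let adj_ne u v : adj u v -> u <> v := adj_neq V adj adj_irrefl u v.

Lemma C_inG p : C p -> inG V adj p.
Proof. apply C_circle. Qed.

(** Remove the point at [t] from the circle. As the point at [s] is absent, the open segment and the
    complement of the closed one disconnect the rest; the vertex [x] lies on the far side. *)
Lemma circle_gap_empty x y t s : adj x y -> 0 < t -> t < s -> s < 1 ->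
  C (ept V x y t) -> ~ C (ept V x y s) -> forall r, t < r < s -> ~ C (ept V x y r).
Proof.
  intros Hxy Ht Hts Hs Ct Cs r Hr Cr. pose proof (adj_ne _ _ Hxy) as N.
  apply (circle_minus_point_connected V adj C
           (edge_seg V x y t s) (off_edge_seg V x y t s)
           (ept V x y t) (ept V x y r) (vtx V x)); auto.
  - apply edge_seg_open; auto; lra.
  - apply off_edge_seg_open; auto; lra.
  - intros q Cq Hq.
    destruct (excluded_middle_informative (off_edge_seg V x y t s q)) as [|Hn]; auto. left.
    apply NNPP in Hn. destruct Hn as (t' & Ht' & ->). exists t'. split; auto.
    destruct (Req_dec t' t) as [->|]; [congruence|].
    destruct (Req_dec t' s) as [->|]; [tauto|]. lra.
  - intros q _ (t' & Ht' & ->) Hoff. apply Hoff. exists t'. split; auto; lra.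
  - intro Eq. apply ept_inj in Eq; auto; try lra.
    destruct Eq as [(_ & _ & ->)|(-> & _)]; [lra|congruence].
  - exists r. auto.
  - apply vtx_neq_ept; auto; lra.
  - intros (t' & Ht' & Eq). revert Eq. apply vtx_neq_ept; auto; lra.
Qed.

Lemma circle_not_isolated p O : C p -> open_G V adj O -> O p -> exists q, C q /\ q <> p /\ O q.
Proof.
  intros Cp HO Op.
  assert (exists v, vtx V v <> p) as [v Hv].
  { destruct (V_infinite []) as [v _]. destruct (V_infinite [v]) as [w Hw].
    destruct (excluded_middle_informative (vtx V v = p)) as [<-|]; eauto.
    exists w. intro E. apply vtx_inj in E. subst. apply Hw. left; auto. }
  destruct (circle_minus_point V adj C (vtx V v) C_circle (C_vtx v)) as (h & Hh & Hsurj & Hinj & Hcont & _).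
  destruct (Hsurj p Cp) as (s & <-); auto.
  destruct (Hcont O HO s Op) as (eps & He & Hball).
  exists (h (s + eps / 2)). split; [apply Hh|]. split.
  - intro E. apply Hinj in E. lra.
  - apply Hball. apply Rabs_def1; lra.
Qed.

(** If the point at [s] were missing, no circle point could lie strictly between [t] and [s], nor
    before [t] on this edge, as that would leave [t] itself in a gap. So the point at [t] would be
    isolated. *)
Lemma circle_edge_right x y t s : adj x y -> 0 < t -> t < s -> s < 1 ->
  C (ept V x y t) -> C (ept V x y s).
Proof.
  intros Hxy Ht Hts Hs Ct. apply NNPP. intro Cs. pose proof (adj_ne _ _ Hxy) as N.
  destruct (circle_not_isolated (ept V x y t) (edge_seg V x y 0 s)) as (q & Cq & Nq & r & Hr & ->); auto.
  { apply edge_seg_open; auto; lra. }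
  { exists t. split; auto. }
  destruct (Rtotal_order r t) as [Hlt|[->|Hgt]].
  - apply (circle_gap_empty x y r s) with (r := t); auto; lra.
  - congruence.
  - apply (circle_gap_empty x y t s) with (r := r); auto; lra.
Qed.

Lemma circle_edge_full x y t s : adj x y -> 0 < t < 1 -> 0 < s < 1 ->
  C (ept V x y t) -> C (ept V x y s).
Proof.
  intros Hxy Ht Hs Ct. pose proof (adj_ne _ _ Hxy) as N.
  destruct (Rtotal_order t s) as [L|[->|L]]; auto.
  - apply circle_edge_right with t; auto; lra.
  - rewrite ept_swap in * by auto. apply circle_edge_right with (1 - t); auto; lra.
Qed.

(** By [circle_edge_full] the midpoint stands for every inner point; it is also the one inner point
    of a cut edge on neither side in the sense of [cut_side]. *)
Definition used (u v : V) : Prop := adj u v /\ C (ept V u v (1/2)).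

Lemma used_sym u v : used u v -> used v u.
Proof.
  intros [H1 H2]. split; auto. rewrite ept_swap in H2 by auto.
  replace (1 - 1/2) with (1/2) in H2 by lra. auto.
Qed.

Variable X : V -> Prop.
(** Only ends on the circle are constrained. This lets [hamilton_contains_end] use a cut that is not
    decided at an end assumed absent. *)
Hypothesis X_ends : forall E, is_end V adj E -> C (PEnd V E) ->
  cut_side V adj X (PEnd V E) \/ cut_side V adj (fun v => ~ X v) (PEnd V E).

Lemma cut_cover q : C q ->
  cut_side V adj X q \/ cut_side V adj (fun v => ~ X v) q \/
  exists u v, used u v /\ X u /\ ~ X v /\ q = ept V u v (1/2).
Proof.
  intro Cq.
  destruct (cut_side_cover V adj adj_sym adj_irrefl X q (C_inG q Cq)) as [H|[H|(u & v & Huv & Xu & Xv & ->)]]; auto.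
  - intros E ->. apply X_ends; auto.
    destruct (C_inG _ Cq) as [(v & Eq)|[(u & v & t & _ & _ & Eq)|(E' & HE' & Eq)]]; try discriminate Eq.
    injection Eq as ->. auto.
  - right. right. exists u, v. repeat split; auto.
Qed.

Lemma cut_not_avoided u0 v0 : X u0 -> ~ X v0 -> exists u v, used u v /\ X u /\ ~ X v.
Proof.
  intros Xu Xv. apply NNPP. intro Hno.
  (* Connectedness is available only after removing a point; a third vertex is a harmless choice. *)
  destruct (V_infinite [u0; v0]) as [w Hw].
  apply (circle_minus_point_connected V adj C (cut_side V adj X) (cut_side V adj (fun v => ~ X v))
           (vtx V w) (vtx V u0) (vtx V v0)); auto using cut_side_open.
  - intros q Cq _. destruct (cut_cover q Cq) as [|[|(u & v & Huv & Hu & Hv & _)]]; auto.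
    exfalso. apply Hno. eauto.
  - intros q _. apply cut_side_disjoint; auto.
  - intro E. apply vtx_inj in E. subst. apply Hw. left; auto.
  - apply cut_side_vtx; auto.
  - intro E. apply vtx_inj in E. subst. apply Hw. right; left; auto.
  - apply cut_side_vtx; auto.
Qed.

Lemma cut_not_single u0 v0 : used u0 v0 -> X u0 -> ~ X v0 ->
  exists u v, used u v /\ X u /\ ~ X v /\ (u, v) <> (u0, v0).
Proof.
  intros Huv Xu Xv. apply NNPP. intro Hno.
  assert (N : forall w, vtx V w <> ept V u0 v0 (1/2)).
  { intro w. apply vtx_neq_ept; try lra. apply adj_ne. apply Huv. }
  apply (circle_minus_point_connected V adj C (cut_side V adj X) (cut_side V adj (fun v => ~ X v))
           (ept V u0 v0 (1/2)) (vtx V u0) (vtx V v0)); auto using cut_side_open.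
  - apply Huv.
  - intros q Cq Nq. destruct (cut_cover q Cq) as [|[|(u & v & Huv' & Hu & Hv & ->)]]; auto.
    exfalso. apply Hno. exists u, v. repeat split; auto; try apply Huv'. congruence.
  - intros q _. apply cut_side_disjoint; auto.
  - apply cut_side_vtx; auto.
  - apply cut_side_vtx; auto.
Qed.

Lemma cut_not_triple u1 v1 u2 v2 u3 v3 :
  used u1 v1 -> used u2 v2 -> used u3 v3 -> X u1 -> X u2 -> X u3 -> ~ X v1 -> ~ X v2 -> ~ X v3 ->
  (u1, v1) <> (u2, v2) -> (u1, v1) <> (u3, v3) -> (u2, v2) <> (u3, v3) ->
  exists u v, used u v /\ X u /\ ~ X v /\ (u, v) <> (u1, v1) /\ (u, v) <> (u2, v2) /\ (u, v) <> (u3, v3).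
Proof.
  intros U1 U2 U3 X1 X2 X3 Y1 Y2 Y3 D12 D13 D23. apply NNPP. intro Hno.
  assert (Hdist : forall u v u' v', used u v -> used u' v' -> X u -> ~ X v -> X u' -> ~ X v' ->
            (u, v) <> (u', v') -> ept V u v (1/2) <> ept V u' v' (1/2)).
  { intros u v u' v' [Hu _] [Hu' _] Xu Xv Xu' Xv' D Eq.
    apply ept_inj in Eq; auto; try lra.
    destruct Eq as [(-> & -> & _)|(-> & -> & _)]; auto. }
  apply (circle_three_crossings V adj C (cut_side V adj X) (cut_side V adj (fun v => ~ X v))
           (ept V u1 v1 (1/2)) (ept V u2 v2 (1/2)) (ept V u3 v3 (1/2))); auto using cut_side_open;
    try apply U1; try apply U2; try apply U3.
  - intros q Cq N1 N2 N3. destruct (cut_cover q Cq) as [|[|(u & v & Huv' & Hu & Hv & ->)]]; auto.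
    exfalso. apply Hno. exists u, v. repeat split; auto; try apply Huv'; congruence.
  - intros q _. apply cut_side_disjoint; auto.
  (* The whole interior of a used edge is in [C], so the circle approaches its midpoint from both
     sides of the cut. *)
  - assert (Hacc : forall u v, used u v -> X u -> ~ X v ->
      ~ cut_side V adj X (ept V u v (1/2)) /\ ~ cut_side V adj (fun v => ~ X v) (ept V u v (1/2)) /\
      forall O, open_G V adj O -> O (ept V u v (1/2)) ->
       (exists q, C q /\ O q /\ cut_side V adj X q) /\
       (exists q, C q /\ O q /\ cut_side V adj (fun v => ~ X v) q)).
    { intros u v [Huv Cuv] Xu Xv. repeat split.
      - intro H. apply cut_side_interior in H; auto; [|lra].
        destruct H as [H|[H|H]]; try tauto; lra.
      - intro H. apply cut_side_interior in H; auto; [|lra].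
        destruct H as [H|[H|H]]; try tauto; lra.
      - destruct (open_G_edge V adj adj_irrefl O u v (1/2)) as (eps & He & Hball); auto; try lra.
        destruct (Hball (1/2 - eps / 2)) as [Hr Or]. { apply Rabs_def1; lra. }
        exists (ept V u v (1/2 - eps / 2)). repeat split; auto.
        + apply circle_edge_full with (1/2); auto; lra.
        + right. left. exists u, v, (1/2 - eps / 2). repeat split; auto; lra.
      - destruct (open_G_edge V adj adj_irrefl O u v (1/2)) as (eps & He & Hball); auto; try lra.
        destruct (Hball (1/2 + eps / 2)) as [Hr Or]. { apply Rabs_def1; lra. }
        exists (ept V u v (1/2 + eps / 2)). repeat split; auto.
        + apply circle_edge_full with (1/2); auto; lra.
        + right. left. exists v, u, (1 - (1/2 + eps / 2)). repeat split; auto; try lra.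
          apply ept_swap; auto. }
    intros p [->|[->| ->]]; auto.
Qed.

(** Of the eight possibilities, five are excluded: none used, exactly one used, and all three used,
    each by the matching lemma above, as it would yield a further crossing edge. *)
Lemma three_cut_uses_two u1 v1 u2 v2 u3 v3 :
  adj u1 v1 -> adj u2 v2 -> adj u3 v3 -> X u1 -> X u2 -> X u3 -> ~ X v1 -> ~ X v2 -> ~ X v3 ->
  (u1, v1) <> (u2, v2) -> (u1, v1) <> (u3, v3) -> (u2, v2) <> (u3, v3) ->
  (forall u v, adj u v -> X u -> ~ X v -> (u, v) = (u1, v1) \/ (u, v) = (u2, v2) \/ (u, v) = (u3, v3)) ->
  (used u1 v1 /\ used u2 v2 /\ ~ used u3 v3) \/
  (used u1 v1 /\ ~ used u2 v2 /\ used u3 v3) \/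
  (~ used u1 v1 /\ used u2 v2 /\ used u3 v3).
Proof.
  intros A1 A2 A3 X1 X2 X3 Y1 Y2 Y3 D12 D13 D23 Hall.
  assert (Hall' : forall u v, used u v -> X u -> ~ X v ->
     ((u, v) = (u1, v1) /\ used u1 v1) \/ ((u, v) = (u2, v2) /\ used u2 v2) \/ ((u, v) = (u3, v3) /\ used u3 v3)).
  { intros u v U Xu Xv. destruct (Hall u v) as [E|[E|E]]; auto; try apply U; injection E as -> ->; auto. }
  destruct (excluded_middle_informative (used u1 v1)) as [U1|U1];
  destruct (excluded_middle_informative (used u2 v2)) as [U2|U2];
  destruct (excluded_middle_informative (used u3 v3)) as [U3|U3]; auto; exfalso.
  - destruct (cut_not_triple u1 v1 u2 v2 u3 v3) as (u & v & U & Xu & Xv & N1 & N2 & N3); auto.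
    destruct (Hall' u v U Xu Xv) as [[E _]|[[E _]|[E _]]]; auto.
  - destruct (cut_not_single u1 v1) as (u & v & U & Xu & Xv & N); auto.
    destruct (Hall' u v U Xu Xv) as [[E ?]|[[E ?]|[E ?]]]; auto.
  - destruct (cut_not_single u2 v2) as (u & v & U & Xu & Xv & N); auto.
    destruct (Hall' u v U Xu Xv) as [[E ?]|[[E ?]|[E ?]]]; auto.
  - destruct (cut_not_single u3 v3) as (u & v & U & Xu & Xv & N); auto.
    destruct (Hall' u v U Xu Xv) as [[E ?]|[[E ?]|[E ?]]]; auto.
  - destruct (cut_not_avoided u1 v1) as (u & v & U & Xu & Xv); auto.
    destruct (Hall' u v U Xu Xv) as [[E ?]|[[E ?]|[E ?]]]; auto.
Qed.

End HamiltonCuts.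

(** * The graph and its ends *)

(* Piece k consists of the vertices (k, w_i): the path w1 ... w9 with the chords w1 w8, w2 w6,
   w3 w9, and w0 attached to w7.  Pieces k and k + 1 are joined by the three edges
   w0 w0, w9 w1 and w4 w5.  The pattern was found by computer search. *)
Inductive idx : Type := w0 | w1 | w2 | w3 | w4 | w5 | w6 | w7 | w8 | w9.

Definition vert : Type := (Z * idx)%type.
Definition lev (v : vert) : Z := fst v.

Definition nbrs (v : vert) : list vert :=
  let k := fst v in
  match snd v with
  | w0 => [((k - 1)%Z, w0); ((k + 1)%Z, w0); (k, w7)]
  | w1 => [((k - 1)%Z, w9); (k, w2); (k, w8)]
  | w2 => [(k, w1); (k, w3); (k, w6)]
  | w3 => [(k, w2); (k, w4); (k, w9)]
  | w4 => [(k, w3); (k, w5); ((k + 1)%Z, w5)]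
  | w5 => [((k - 1)%Z, w4); (k, w4); (k, w6)]
  | w6 => [(k, w5); (k, w7); (k, w2)]
  | w7 => [(k, w6); (k, w8); (k, w0)]
  | w8 => [(k, w7); (k, w9); (k, w1)]
  | w9 => [(k, w8); ((k + 1)%Z, w1); (k, w3)]
  end.

Definition gadj (u v : vert) : Prop := In v (nbrs u).

Ltac pair_eqs :=
  repeat match goal with
  | H : (_, _) = (_, _) |- _ => injection H; clear H; intros; subst
  | H : False |- _ => contradiction H
  | H : _ \/ _ |- _ => destruct H
  end.

Ltac vert_eq := first [reflexivity | apply f_equal2; [lia | reflexivity]].

Lemma gadj_sym u v : gadj u v -> gadj v u.
Proof.
  destruct u as [k i], v as [m j]. unfold gadj.
  destruct i; simpl; intro H; pair_eqs; simpl;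
    first [left; vert_eq | right; left; vert_eq | right; right; left; vert_eq].
Qed.

Lemma gadj_irrefl v : ~ gadj v v.
Proof.
  destruct v as [k i]. unfold gadj.
  destruct i; simpl; intro H; repeat destruct H as [H|H]; try discriminate H; auto;
    injection H; lia.
Qed.

Lemma gadj_degree v : has_degree vert gadj v 3.
Proof.
  exists (nbrs v). split; [|split].
  - destruct v as [k i]. destruct i; simpl; repeat constructor; simpl; intro H;
      repeat destruct H as [H|H]; try discriminate H; auto; injection H; lia.
  - destruct v as [k i]. destruct i; reflexivity.
  - intro x. reflexivity.
Qed.

Lemma gadj_lev u v : gadj u v -> (lev u - 1 <= lev v <= lev u + 1)%Z.
Proof.
  destruct u as [k i], v as [m j]. unfold gadj, lev.
  destruct i; simpl; intro H; pair_eqs; lia.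
Qed.

Lemma vert_infinite : infinite_graph vert.
Proof.
  intro l.
  destruct (injective_leaves_list vert (fun n => (Z.of_nat n, w0)) l) as [N HN].
  { intros n m E. injection E. lia. }
  exists (Z.of_nat N, w0). apply HN. lia.
Qed.

Lemma piece_reach (A : vert -> Prop) k i : (forall j, A (k, j)) -> reach vert gadj A (k, i) (k, w0).
Proof.
  intro HA.
  assert (st : forall i j, gadj (k, i) (k, j) ->
     reach vert gadj A (k, j) (k, w0) -> reach vert gadj A (k, i) (k, w0)).
  { intros a b Hab. apply reach_trans. apply reach_adj; auto. }
  assert (R0 : reach vert gadj A (k, w0) (k, w0)) by (apply reach_refl; auto).
  assert (R7 : reach vert gadj A (k, w7) (k, w0)) by (apply (st w7 w0); auto; unfold gadj; simpl; auto).
  assert (R6 : reach vert gadj A (k, w6) (k, w0)) by (apply (st w6 w7); auto; unfold gadj; simpl; auto).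
  assert (R5 : reach vert gadj A (k, w5) (k, w0)) by (apply (st w5 w6); auto; unfold gadj; simpl; auto).
  assert (R4 : reach vert gadj A (k, w4) (k, w0)) by (apply (st w4 w5); auto; unfold gadj; simpl; auto).
  assert (R3 : reach vert gadj A (k, w3) (k, w0)) by (apply (st w3 w4); auto; unfold gadj; simpl; auto).
  assert (R2 : reach vert gadj A (k, w2) (k, w0)) by (apply (st w2 w3); auto; unfold gadj; simpl; auto).
  assert (R1 : reach vert gadj A (k, w1) (k, w0)) by (apply (st w1 w2); auto; unfold gadj; simpl; auto).
  assert (R8 : reach vert gadj A (k, w8) (k, w0)) by (apply (st w8 w7); auto; unfold gadj; simpl; auto).
  assert (R9 : reach vert gadj A (k, w9) (k, w0)) by (apply (st w9 w8); auto; unfold gadj; simpl; auto).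
  destruct i; assumption.
Qed.

Lemma levels_reach_up (A : vert -> Prop) k n :
  (forall v, (k <= lev v <= k + Z.of_nat n)%Z -> A v) ->
  reach vert gadj A (k, w0) ((k + Z.of_nat n)%Z, w0).
Proof.
  induction n; intro HA.
  - rewrite Z.add_0_r. apply reach_refl. apply HA. simpl; lia.
  - eapply reach_step.
    + apply IHn. intros v Hv. apply HA. lia.
    + unfold gadj. simpl. right. left. vert_eq.
    + apply HA. unfold lev; cbn [fst]; lia.
Qed.

Ltac lev_lia := unfold lev in *; cbn [fst snd] in *; lia.

(** Pieces are connected and consecutive ones are joined by [w0 w0], so no level outside the range
    is visited. A finite set therefore cannot separate vertices beyond it on the same side. *)
Lemma levels_reach (A : vert -> Prop) u v :
  (forall x, (Z.min (lev u) (lev v) <= lev x <= Z.max (lev u) (lev v))%Z -> A x) ->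
  reach vert gadj A u v.
Proof.
  destruct u as [k i], v as [m j]. intro HA.
  apply reach_trans with (k, w0).
  { apply piece_reach. intro. apply HA. lev_lia. }
  apply reach_trans with (m, w0).
  2:{ apply reach_sym. apply gadj_sym. apply piece_reach. intro. apply HA. lev_lia. }
  destruct (Z_le_gt_dec k m).
  - replace m with (k + Z.of_nat (Z.to_nat (m - k)))%Z by lia.
    apply levels_reach_up. intros v Hv. apply HA. lev_lia.
  - apply reach_sym. { apply gadj_sym. }
    replace k with (m + Z.of_nat (Z.to_nat (k - m)))%Z by lia.
    apply levels_reach_up. intros v Hv. apply HA. lev_lia.
Qed.

Lemma graph_connected : connected vert gadj.
Proof. intros u v. apply levels_reach. auto. Qed.

Definition level_verts (k : Z) : list vert :=
  map (fun i => (k, i)) [w0; w1; w2; w3; w4; w5; w6; w7; w8; w9].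

Lemma in_level_verts k v : In v (level_verts k) <-> lev v = k.
Proof.
  destruct v as [m i]. unfold lev; cbn [fst]. split.
  - simpl. intro H. repeat destruct H as [H|H]; try (injection H; congruence). contradiction.
  - intros ->. destruct i; simpl; auto 12.
Qed.

(* The two ends are indexed by a sign: sg = 1 is the right end, sg = -1 the left one. *)
Definition is_sign (sg : Z) : Prop := sg = 1%Z \/ sg = (-1)%Z.

Definition tends (sg : Z) (r : nat -> vert) : Prop :=
  forall K, exists N, forall n, (N <= n)%nat -> (K < sg * lev (r n))%Z.

Definition the_end (sg : Z) (r : nat -> vert) : Prop := is_ray vert gadj r /\ tends sg r.

Lemma list_lev_bound (S : list vert) : exists K, forall v, In v S -> (- K < lev v < K)%Z.
Proof.
  induction S as [|x S [K HK]]. { exists 0%Z. intros v []. }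
  exists (Z.max K (Z.abs (lev x) + 1)). intros v [<-|Hv]; [lia|]. specialize (HK v Hv). lia.
Qed.

Lemma window_list K : exists S : list vert, forall v, (- K <= lev v <= K)%Z -> In v S.
Proof.
  assert (H : forall n : nat, exists S, forall v, (- Z.of_nat n <= lev v <= Z.of_nat n)%Z -> In v S).
  { induction n as [|n [S HS]].
    - exists (level_verts 0). intros v Hv. apply in_level_verts. lia.
    - exists (level_verts (Z.of_nat n + 1) ++ level_verts (- (Z.of_nat n + 1)) ++ S).
      intros v Hv. rewrite !in_app_iff, !in_level_verts.
      destruct (Z.eq_dec (lev v) (Z.of_nat n + 1)); auto.
      destruct (Z.eq_dec (lev v) (- (Z.of_nat n + 1))); auto.
      right. right. apply HS. lia. }
  destruct (H (Z.to_nat K)) as [S HS]. exists S. intros v Hv. apply HS. lia.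
Qed.

(** A ray eventually avoids the finite window for good; as the level changes by at most one per
    step, it cannot jump from one side of the window to the other. *)
Lemma ray_leaves_window r K : is_ray vert gadj r ->
  exists N sg, is_sign sg /\ forall n, (N <= n)%nat -> (K < sg * lev (r n))%Z.
Proof.
  intros [Hinj Hadj]. destruct (window_list (Z.max K 0)) as [S HS].
  destruct (injective_leaves_list vert r S Hinj) as [N HN].
  exists N.
  assert (Hout : forall n, (N <= n)%nat -> ~ (- Z.max K 0 <= lev (r n) <= Z.max K 0)%Z).
  { intros n Hn H. apply (HN n Hn). auto. }
  destruct (Z_lt_ge_dec (Z.max K 0) (lev (r N))) as [L|L].
  - exists 1%Z. split. { left; auto. }
    assert (forall d, (Z.max K 0 < lev (r (N + d)%nat))%Z) as H.
    { induction d. { rewrite Nat.add_0_r; auto. }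
      rewrite Nat.add_succ_r. pose proof (gadj_lev _ _ (Hadj (N + d)%nat)).
      specialize (Hout (Datatypes.S (N + d))). lia. }
    intros n Hn. specialize (H (n - N)%nat). replace (N + (n - N))%nat with n in H by lia. lia.
  - exists (-1)%Z. split. { right; auto. }
    assert (forall d, (lev (r (N + d)%nat) < - Z.max K 0)%Z) as H.
    { induction d. { rewrite Nat.add_0_r. specialize (Hout N). lia. }
      rewrite Nat.add_succ_r. pose proof (gadj_lev _ _ (Hadj (N + d)%nat)).
      specialize (Hout (Datatypes.S (N + d))). lia. }
    intros n Hn. specialize (H (n - N)%nat). replace (N + (n - N))%nat with n in H by lia. lia.
Qed.

Lemma ray_tends r : is_ray vert gadj r -> exists sg, is_sign sg /\ tends sg r.
Proof.
  intro Hr. destruct (ray_leaves_window r 0 Hr) as (N & sg & Hsg & HN).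
  exists sg. split; auto. intro K.
  (* The sign found for the larger window agrees with [sg], since a late vertex satisfies both
     inequalities. *)
  destruct (ray_leaves_window r (Z.max K 0) Hr) as (M & sg' & Hsg' & HM).
  exists (Nat.max N M). intros n Hn. specialize (HN n). specialize (HM n).
  destruct Hsg as [->| ->], Hsg' as [->| ->]; lia.
Qed.

Lemma tends_equiv sg r r' : is_sign sg -> tends sg r -> tends sg r' -> ray_equiv vert gadj r r'.
Proof.
  intros Hsg Hr Hr' S. destruct (list_lev_bound S) as [K HK].
  destruct (Hr K) as [N HN]. destruct (Hr' K) as [N' HN'].
  exists (Nat.max N N'). intros i j Hi Hj. apply levels_reach. intros x Hx Hin.
  specialize (HK x Hin). specialize (HN i). specialize (HN' j).
  destruct Hsg as [->| ->]; lia.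
Qed.

(** One full level is a separator, because an edge changes the level by at most one. *)
Lemma side_invariant sg K u v : is_sign sg ->
  reach vert gadj (avoid vert (level_verts (sg * K))) u v -> (K < sg * lev u)%Z -> (K < sg * lev v)%Z.
Proof.
  intros Hsg. apply (reach_invariant _ _ _ (fun v => (K < sg * lev v)%Z)). intros x y _ Hy Hxy Hx.
  pose proof (gadj_lev _ _ Hxy). unfold avoid in Hy. rewrite in_level_verts in Hy.
  destruct Hsg as [->| ->]; lia.
Qed.

Lemma equiv_tends sg r r' : is_sign sg -> ray_equiv vert gadj r r' -> is_ray vert gadj r' ->
  tends sg r -> tends sg r'.
Proof.
  intros Hsg Heq Hr' Hr K.
  destruct (Hr K) as [N HN]. destruct (Heq (level_verts (sg * K))) as [M HM].
  exists (Nat.max N M). intros n Hn. apply (side_invariant sg K (r (Nat.max N M))); auto.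
  - apply HM; lia.
  - apply HN; lia.
Qed.

Lemma end_cases E : is_end vert gadj E -> exists sg, is_sign sg /\ E = the_end sg.
Proof.
  intros (r & Hr & HE). destruct (ray_tends r Hr) as (sg & Hsg & Ht).
  exists sg. split; auto. extensionality r'. apply propositional_extensionality.
  rewrite HE. unfold the_end. split; intros [H1 H2]; split; auto.
  - eapply equiv_tends; eauto.
  - eapply tends_equiv; eauto.
Qed.

(** * Three disjoint rays towards each end *)

Section StepRay.
Variables (sg : Z) (step : vert -> vert) (inv : vert -> Prop) (rank : vert -> Z) (v0 : vert).
Hypothesis inv_v0 : inv v0.
Hypothesis inv_step : forall v, inv v ->
  inv (step v) /\ gadj v (step v) /\ (rank v + 1 <= rank (step v))%Z.
(** Strict growth of [rank] makes the iterates distinct, and this bound turns it into growth of the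
    level; the factor 3 leaves room for three vertices of a track in one level. *)
Hypothesis rank_lev : forall v, (rank v <= 3 * (sg * lev v) + 2)%Z.

Definition step_ray (n : nat) : vert := Nat.iter n step v0.

Lemma step_ray_inv n : inv (step_ray n).
Proof. induction n; simpl; auto. apply inv_step; auto. Qed.

Lemma step_ray_rank n d : (rank (step_ray n) + Z.of_nat d <= rank (step_ray (n + d)))%Z.
Proof.
  induction d. { rewrite Nat.add_0_r. lia. }
  rewrite Nat.add_succ_r. change (step_ray (S (n + d))) with (step (step_ray (n + d))).
  pose proof (inv_step _ (step_ray_inv (n + d))). lia.
Qed.

Lemma step_ray_end : the_end sg step_ray.
Proof.
  split; [split|].
  - assert (H : forall n m, (n < m)%nat -> step_ray n <> step_ray m).
    { intros n m L E. pose proof (step_ray_rank n (m - n)) as H.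
      replace (n + (m - n))%nat with m in H by lia. rewrite E in H. lia. }
    intros n m E. destruct (Nat.lt_trichotomy n m) as [L|[L|L]]; auto; exfalso; eapply H; eauto.
  - intro n. apply (inv_step _ (step_ray_inv n)).
  - intro K. exists (Z.to_nat (3 * (K + 1) - rank v0)). intros n Hn.
    pose proof (step_ray_rank 0 n) as H. simpl Nat.add in H.
    pose proof (rank_lev (step_ray n)). unfold step_ray at 1 in H. simpl in H. lia.
Qed.

End StepRay.

(** Position along the track, read in the direction [sg]: within a level the order [w1], [w8], [w9]
    and [w5], [w4] is reversed for the left end. *)
Definition rank (sg : Z) (v : vert) : Z :=
  (3 * (sg * lev v) + match snd v with
  | w8 => 1
  | w1 | w5 => if (sg =? 1)%Z then 0 else 2
  | w9 | w4 => if (sg =? 1)%Z then 2 else 0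
  | _ => 0
  end)%Z.

(** The three tracks are the line of the [w0], the path through [w1], [w8], [w9], which takes the
    chord [w1 w8], and the path through [w5], [w4]. Each uses its own edge between consecutive
    pieces. Off the tracks the value is a dummy. *)
Definition step (sg : Z) (v : vert) : vert :=
  match snd v with
  | w0 => ((fst v + sg)%Z, w0)
  | w1 => if (sg =? 1)%Z then (fst v, w8) else ((fst v - 1)%Z, w9)
  | w8 => if (sg =? 1)%Z then (fst v, w9) else (fst v, w1)
  | w9 => if (sg =? 1)%Z then ((fst v + 1)%Z, w1) else (fst v, w8)
  | w5 => if (sg =? 1)%Z then (fst v, w4) else ((fst v - 1)%Z, w4)
  | w4 => if (sg =? 1)%Z then ((fst v + 1)%Z, w5) else (fst v, w5)
  | _ => v
  end.

Definition track (a : nat) (v : vert) : Prop :=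
  match a with
  | 0%nat => snd v = w0
  | 1%nat => snd v = w1 \/ snd v = w8 \/ snd v = w9
  | _ => snd v = w5 \/ snd v = w4
  end.

Definition track_start (a : nat) : vert :=
  match a with 0%nat => (0%Z, w0) | 1%nat => (0%Z, w1) | _ => (0%Z, w5) end.

Lemma step_track sg a v : is_sign sg -> track a v ->
  track a (step sg v) /\ gadj v (step sg v) /\ (rank sg v + 1 <= rank sg (step sg v))%Z.
Proof.
  destruct v as [k i].
  intros [->| ->]; destruct a as [|[|a]]; simpl; intro H;
    repeat match goal with H : _ \/ _ |- _ => destruct H end; subst i;
    unfold step, rank, gadj, lev; cbn [fst snd Z.eqb Pos.eqb];
    (split; [simpl; auto | split; [simpl; auto | lia]]).
Qed.

Lemma the_end_three_rays sg : is_sign sg -> has_vdisjoint_rays vert (the_end sg) 3.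
Proof.
  intro Hsg. exists (fun a => step_ray (step sg) (track_start a)).
  split.
  - intros a _. apply (step_ray_end sg (step sg) (track a) (rank sg)).
    + destruct a as [|[|a]]; simpl; auto.
    + intros v Hv. apply step_track; auto.
    + intros [k i]. unfold rank, lev. cbn [fst snd].
      destruct Hsg as [->| ->]; destruct i; simpl; lia.
  - intros a b Ha Hb Hab n m E.
    pose proof (step_ray_inv (step sg) (track a) (rank sg) (track_start a)) as Ia.
    pose proof (step_ray_inv (step sg) (track b) (rank sg) (track_start b)) as Ib.
    assert (Ta : track a (step_ray (step sg) (track_start a) n)).
    { apply Ia. destruct a as [|[|a]]; simpl; auto. intros; apply step_track; auto. }
    assert (Tb : track b (step_ray (step sg) (track_start b) m)).
    { apply Ib. destruct b as [|[|b]]; simpl; auto. intros; apply step_track; auto. }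
    rewrite <- E in Tb.
    destruct a as [|[|[|a]]], b as [|[|[|b]]]; try lia; simpl in Ta, Tb;
      repeat match goal with H : _ \/ _ |- _ => destruct H end; congruence.
Qed.

(** * Upper bound for the degrees of the ends *)

Lemma level_cut k u v : gadj u v -> (lev u < k)%Z -> ~ (lev v < k)%Z ->
  (u, v) = (((k - 1)%Z, w0), (k, w0)) \/
  (u, v) = (((k - 1)%Z, w9), (k, w1)) \/
  (u, v) = (((k - 1)%Z, w4), (k, w5)).
Proof.
  destruct u as [a i], v as [b j]. unfold gadj, lev; cbn [fst].
  destruct i; simpl; intros H H1 H2; repeat destruct H as [H|H]; try contradiction;
    injection H; intros; subst; try lia;
    (assert (Ek : k = (a + 1)%Z) by lia; subst k;
     replace (a + 1 - 1)%Z with a by lia; auto).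
Qed.

Lemma crossing (P : nat -> Prop) n : P 0%nat -> ~ P n -> exists m, P m /\ ~ P (S m).
Proof.
  intros H0. induction n; intro Hn. { contradiction. }
  destruct (excluded_middle_informative (P n)); eauto.
Qed.

(** Four rays towards one end all have to cross a three-edge cut beyond their starting vertices, so
    two of them share an edge. *)
Lemma the_end_edge_bound sg m : is_sign sg -> (3 < m)%nat -> ~ has_edisjoint_rays vert (the_end sg) m.
Proof.
  intros Hsg Hm (rs & Hrs & Hdis).
  destruct (list_lev_bound [rs 0%nat 0%nat; rs 1%nat 0%nat; rs 2%nat 0%nat; rs 3%nat 0%nat]) as [K HK].
  (* [k] is the upper level of the cut: it lies between K - 1 and K for the right end, and between
     -K and 1 - K for the left end. *)
  set (k := if (sg =? 1)%Z then K else (1 - K)%Z).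
  set (c := fun a : nat => match a with
     | 0%nat => (((k - 1)%Z, w0), (k, w0)) | 1%nat => (((k - 1)%Z, w9), (k, w1))
     | _ => (((k - 1)%Z, w4), (k, w5)) end : vert * vert).
  assert (Hc : forall i, (i < 4)%nat -> exists a n, (a < 3)%nat /\
     same_edge vert (fst (c a)) (snd (c a)) (rs i n) (rs i (S n))).
  { intros i Hi.
    assert (H0 : (- K < lev (rs i 0%nat) < K)%Z).
    { apply HK. destruct i as [|[|[|[|i]]]]; simpl; auto; lia. }
    destruct (Hrs i) as [[_ Hadj] Ht]; [lia|].
    destruct (Ht K) as [N HN]. specialize (HN N (le_n _)).
    destruct (crossing (fun n => (sg * lev (rs i n) < K)%Z) N) as (n & Hn & Hn').
    { destruct Hsg as [->| ->]; lia. } { lia. }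
    specialize (Hadj n). subst k.
    assert (Hcut : (exists a, (a < 3)%nat /\ (rs i n, rs i (S n)) = c a) \/
                   (exists a, (a < 3)%nat /\ (rs i (S n), rs i n) = c a)).
    { destruct Hsg as [->| ->]; simpl Z.eqb in *; cbv iota in *.
      - left. destruct (level_cut K (rs i n) (rs i (S n))) as [E|[E|E]]; auto; try lia.
        + exists 0%nat. auto. + exists 1%nat. auto. + exists 2%nat. auto.
      - right. destruct (level_cut (1 - K) (rs i (S n)) (rs i n)) as [E|[E|E]]; auto using gadj_sym; try lia.
        + exists 0%nat. auto. + exists 1%nat. auto. + exists 2%nat. auto. }
    destruct Hcut as [(a & Ha & E)|(a & Ha & E)]; exists a, n; split; auto; rewrite <- E; simpl;
      [left|right]; auto. }
  destruct (Hc 0%nat) as (a0 & n0 & A0 & E0); [lia|]. destruct (Hc 1%nat) as (a1 & n1 & A1 & E1); [lia|].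
  destruct (Hc 2%nat) as (a2 & n2 & A2 & E2); [lia|]. destruct (Hc 3%nat) as (a3 & n3 & A3 & E3); [lia|].
  assert (col : forall i j a n n', (i < 4)%nat -> (j < 4)%nat -> i <> j ->
     same_edge vert (fst (c a)) (snd (c a)) (rs i n) (rs i (S n)) ->
     same_edge vert (fst (c a)) (snd (c a)) (rs j n') (rs j (S n')) -> False).
  { intros i j a n n' Hi Hj Hij S1 S2. apply (Hdis i j) with n n'; auto; try lia.
    unfold same_edge in *. intuition congruence. }
  assert (a0 = a1 \/ a0 = a2 \/ a0 = a3 \/ a1 = a2 \/ a1 = a3 \/ a2 = a3) as Hp by lia.
  destruct Hp as [->|[->|[->|[->|[->| ->]]]]].
  - apply (col 0 1 a1 n0 n1)%nat; auto; lia.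
  - apply (col 0 2 a2 n0 n2)%nat; auto; lia.
  - apply (col 0 3 a3 n0 n3)%nat; auto; lia.
  - apply (col 1 2 a2 n1 n2)%nat; auto; lia.
  - apply (col 1 3 a3 n1 n3)%nat; auto; lia.
  - apply (col 2 3 a3 n2 n3)%nat; auto; lia.
Qed.

Lemma vdisjoint_edisjoint (E : (nat -> vert) -> Prop) k :
  has_vdisjoint_rays vert E k -> has_edisjoint_rays vert E k.
Proof.
  intros (rs & H1 & H2). exists rs. split; auto.
  intros i j Hi Hj Hij n m [[H _]|[H _]]; exact (H2 i j Hi Hj Hij _ _ H).
Qed.

Lemma end_degrees E : is_end vert gadj E -> end_vertex_degree vert E 3 /\ end_edge_degree vert E 3.
Proof.
  intro HE. destruct (end_cases E HE) as (sg & Hsg & ->).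
  pose proof (the_end_three_rays sg Hsg) as H3.
  repeat split; auto using vdisjoint_edisjoint.
  - intros m Hm H. apply (the_end_edge_bound sg m); auto using vdisjoint_edisjoint.
  - intros m Hm H. apply (the_end_edge_bound sg m); auto.
Qed.

Lemma the_end_is_end sg : is_sign sg -> is_end vert gadj (the_end sg).
Proof.
  intro Hsg. destruct (the_end_three_rays sg Hsg) as (rs & H & _).
  destruct (H 0%nat) as [Hr Ht]; [lia|].
  exists (rs 0%nat). split; auto. intro r'. unfold the_end. split; intros [H1 H2]; split; auto.
  - eapply tends_equiv; eauto.
  - eapply equiv_tends; eauto.
Qed.

Lemma in_comp_level sg K x : is_sign sg ->
  in_comp vert gadj (level_verts (sg * K)) (the_end sg) x -> (K < sg * lev x)%Z.
Proof.
  intros Hsg (r & [Hr Ht] & N & HN). destruct (Ht K) as [M HM].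
  apply (side_invariant sg K (r (Nat.max N M))); auto.
  - apply HN; lia.
  - apply HM; lia.
Qed.

Lemma in_comp_far sg S : is_sign sg -> exists K, forall x, (K < sg * lev x)%Z ->
  in_comp vert gadj S (the_end sg) x.
Proof.
  intro Hsg. destruct (list_lev_bound S) as [K HK]. exists K. intros x Hx.
  destruct (the_end_three_rays sg Hsg) as (rs & H & _).
  destruct (H 0%nat) as [Hr Ht]; [lia|]. destruct (Ht K) as [N HN].
  exists (rs 0%nat). split. { split; auto. }
  exists N. intros i Hi. apply levels_reach. intros y Hy Hin.
  specialize (HK y Hin). specialize (HN i Hi). destruct Hsg as [->| ->]; lia.
Qed.

Lemma cut_side_end sg K (X : vert -> Prop) : is_sign sg ->
  (forall v, (K < sg * lev v)%Z -> X v) -> cut_side vert gadj X (PEnd vert (the_end sg)).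
Proof.
  (* The separator is one level further out than [K], so that neighbours of its far component still
     lie beyond [K]. *)
  intros Hsg HX. right. right. exists (the_end sg), (level_verts (sg * (K + 1))).
  split; [apply the_end_is_end; auto|]. split; auto.
  intros x y Hx Hxy. apply in_comp_level in Hx; auto. pose proof (gadj_lev _ _ Hxy).
  split; apply HX; destruct Hsg as [->| ->]; lia.
Qed.

(** * Edges of a Hamilton circle inside a piece *)

(* Contract everything left of piece k to one vertex (number 0) and everything right of it
   to another (number 1); the vertex w_i of piece k gets number i + 2. *)
Definition loc (k : Z) (v : vert) : nat :=
  if (lev v <? k)%Z then 0%nat else if (k <? lev v)%Z then 1%nat else
  match snd v with
  | w0 => 2 | w1 => 3 | w2 => 4 | w3 => 5 | w4 => 6 | w5 => 7 | w6 => 8 | w7 => 9 | w8 => 10 | w9 => 11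
  end%nat.

(** The positions are used as edge numbers throughout: 0 to 2 on the left, 3 to 5 on the right, 6 to
    13 the path from [w1] to [w9], 14 to 17 the edge [w0 w7] and the chords. *)
Definition piece_edges (k : Z) : list (vert * vert) :=
  [ (((k - 1)%Z, w0), (k, w0)); (((k - 1)%Z, w9), (k, w1)); (((k - 1)%Z, w4), (k, w5));
    ((k, w0), ((k + 1)%Z, w0)); ((k, w9), ((k + 1)%Z, w1)); ((k, w4), ((k + 1)%Z, w5));
    ((k, w1), (k, w2)); ((k, w2), (k, w3)); ((k, w3), (k, w4)); ((k, w4), (k, w5));
    ((k, w5), (k, w6)); ((k, w6), (k, w7)); ((k, w7), (k, w8)); ((k, w8), (k, w9));
    ((k, w0), (k, w7)); ((k, w1), (k, w8)); ((k, w2), (k, w6)); ((k, w3), (k, w9)) ].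

Definition edge_ends : list (nat * nat) :=
  [ (0, 2); (0, 3); (0, 7); (2, 1); (11, 1); (6, 1);
    (3, 4); (4, 5); (5, 6); (6, 7); (7, 8); (8, 9); (9, 10); (10, 11);
    (2, 9); (3, 10); (4, 8); (5, 11) ]%nat.

(** Edge numbers at each vertex of the contracted piece, in the numbering of [loc]. The first two
    triples belong to the contracted vertices and encode the cuts between consecutive pieces. *)
Definition incident : list (nat * nat * nat) :=
  [ (0, 1, 2); (3, 4, 5); (0, 3, 14); (1, 6, 15); (6, 7, 16); (7, 8, 17); (8, 9, 5);
    (2, 9, 10); (10, 11, 16); (11, 12, 14); (12, 13, 15); (13, 4, 17) ]%nat.

Definition exact2 (a b c : bool) : bool :=
  if a then xorb b c else andb b c.

Definition bit (e : list bool) (n : nat) : bool := nth n e false.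

Definition degrees_ok (e : list bool) : bool :=
  forallb (fun t : nat * nat * nat => let '(a, b, c) := t in exact2 (bit e a) (bit e b) (bit e c)) incident.

Definition crosses (e c : list bool) : bool :=
  existsb (fun t : nat * nat * bool => let '(a, b, x) := t in if x then xorb (bit c a) (bit c b) else false)
    (combine edge_ends e).

Fixpoint all_bits (n : nat) : list (list bool) :=
  match n with
  | O => [[]]
  | S n => map (cons true) (all_bits n) ++ map (cons false) (all_bits n)
  end.

(* The 2-colourings of the contracted piece in which the right vertex is outside
   and some vertex is inside. *)
Definition sides : list (list bool) :=
  filter (fun c => existsb (fun b => b) c)
    (map (fun c => bit c 0 :: false :: tl c) (all_bits 11)).

(** Used are [w0 w0] and [w9 w1] on both sides and the whole path from [w1] to [w9]. *)
Definition ham_bits : list bool :=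
  [true; true; false; true; true; false; true; true; true; true; true; true; true; true;
   false; false; false; false].

(* The entries 1 and 3 are the edge from w9 to w1 on the left of the piece and the edge from
   w0 to w0 on its right. *)
Definition piece_check (e : list bool) : bool :=
  if forallb (crosses e) sides then
    bit e 1 && bit e 3 &&
    (if bit e 2 then true else if bit e 5 then true else
     if list_eq_dec bool_dec e ham_bits then true else false)
  else true.

(* Enumerates the vectors satisfying degrees_ok entry by entry with pruning, so that the finite
   check does not run through all 2^18 vectors. *)
Fixpoint search (n : nat) : list (list bool) :=
  match n with
  | O => [[]]
  | S n =>
    filter (fun e => forallb (fun t : nat * nat * nat => let '(a, b, c) := t in
              if (Nat.max a (Nat.max b c) =? n)%nat
              then exact2 (bit e a) (bit e b) (bit e c) else true) incident)
      (flat_map (fun e => [e ++ [true]; e ++ [false]]) (search n))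
  end.

(** Pruning loses no solution: a triple is tested as soon as its largest edge number is assigned,
    and prefixes of a solution pass all these tests. *)
Lemma search_complete e n : degrees_ok e = true -> (n <= length e)%nat -> In (firstn n e) (search n).
Proof.
  intros Hd. induction n; intro Hn. { left; auto. }
  assert (Hb : forall a, (a <= n)%nat -> bit (firstn (S n) e) a = bit e a).
  { intros a Ha. unfold bit. rewrite nth_firstn. destruct (Nat.ltb_spec a (S n)); auto; lia. }
  cbn [search]. apply filter_In. split.
  - apply in_flat_map. exists (firstn n e). split; [apply IHn; lia|].
    assert (E : firstn (S n) e = firstn n e ++ [bit e n]).
    { clear - Hn. revert n Hn. induction e as [|x e IH]; simpl; intros n Hn; [lia|].
      destruct n; auto. simpl. f_equal. apply IH. lia. }
    rewrite E. destruct (bit e n); simpl; auto.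
  - apply forallb_forall. intros [[a b] c] Ht.
    unfold degrees_ok in Hd. rewrite forallb_forall in Hd. specialize (Hd _ Ht). simpl in Hd.
    destruct (Nat.eqb_spec (Nat.max a (Nat.max b c)) n); auto.
    rewrite !Hb by lia. exact Hd.
Qed.

Lemma piece_check_all : forallb piece_check (search 18) = true.
Proof. vm_compute. reflexivity. Qed.

Lemma piece_forced e : length e = 18%nat -> degrees_ok e = true ->
  (forall c, In c sides -> crosses e c = true) ->
  bit e 1 = true /\ bit e 3 = true /\ (bit e 2 = false -> bit e 5 = false -> e = ham_bits).
Proof.
  intros Hl Hd Hc. pose proof piece_check_all as H. rewrite forallb_forall in H.
  assert (Hin : In e (search 18)).
  { rewrite <- (firstn_all e) at 1. rewrite Hl. apply search_complete; auto; lia. }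
  specialize (H e Hin). unfold piece_check in H.
  assert (Hf : forallb (crosses e) sides = true) by (apply forallb_forall; auto).
  rewrite Hf in H. apply andb_prop in H. destruct H as [H H3]. apply andb_prop in H.
  destruct H as [H1 H2]. split; auto. split; auto. intros E2 E5. rewrite E2, E5 in H3.
  destruct (list_eq_dec bool_dec e ham_bits); [auto|discriminate].
Qed.

Lemma piece_edges_loc k : map (fun p => (loc k (fst p), loc k (snd p))) (piece_edges k) = edge_ends.
Proof.
  unfold piece_edges, loc, lev. cbn [map fst snd].
  assert (H1 : (k - 1 <? k)%Z = true) by lia. assert (H2 : (k <? k)%Z = false) by lia.
  assert (H3 : (k + 1 <? k)%Z = false) by lia. assert (H4 : (k <? k + 1)%Z = true) by lia.
  rewrite H1, H2, H3, H4. reflexivity.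
Qed.

Lemma piece_edges_complete k u v : gadj u v -> loc k u <> loc k v ->
  In (u, v) (piece_edges k) \/ In (v, u) (piece_edges k).
Proof.
  destruct u as [a i], v as [b j]. intros H Hloc.
  assert (Hk : a = k \/ b = k).
  { pose proof (gadj_lev _ _ H). revert Hloc. unfold loc, lev in *. cbn [fst snd] in *.
    destruct (Z.ltb_spec a k), (Z.ltb_spec k a), (Z.ltb_spec b k), (Z.ltb_spec k b); lia. }
  unfold gadj in H. clear Hloc.
  destruct i; simpl in H; repeat destruct H as [H|H]; try contradiction;
    injection H; intros; subst j b; destruct Hk; subst;
    unfold piece_edges; simpl;
    try replace (a + 1 - 1)%Z with a by lia; try replace (a - 1 + 1)%Z with a by lia; auto 20.
Qed.

Lemma in_combine_map {A B D : Type} (f : A -> B) (g : A -> D) l x :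
  In x l -> In (f x, g x) (combine (map f l) (map g l)).
Proof. induction l; simpl; auto. intros [->|H]; auto. Qed.

Lemma bit_sides_right c : In c sides -> bit c 1 = false.
Proof.
  unfold sides. intro H. apply filter_In in H. destruct H as [H _].
  apply in_map_iff in H. destruct H as (c' & <- & _). reflexivity.
Qed.

(** * Local constraints on an arbitrary Hamilton circle *)

Section PieceUniqueness.
Variable C : point vert -> Prop.
Hypothesis C_hamilton : hamilton_circle vert gadj C.

Let used_edge := used vert gadj C.

Definition used_bit (u v : vert) : bool :=
  if excluded_middle_informative (used vert gadj C u v) then true else false.

Lemma used_bit_spec u v : used_bit u v = true <-> used_edge u v.
Proof.
  unfold used_bit, used_edge. destruct (excluded_middle_informative (used vert gadj C u v)); split; auto.
  discriminate.
Qed.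

Lemma used_bit_sym u v : used_bit u v = used_bit v u.
Proof.
  apply Bool.eq_true_iff_eq. rewrite !used_bit_spec.
  split; apply used_sym; auto using gadj_sym, gadj_irrefl.
Qed.

Lemma exact2_used u1 v1 u2 v2 u3 v3 :
  (used_edge u1 v1 /\ used_edge u2 v2 /\ ~ used_edge u3 v3) \/
  (used_edge u1 v1 /\ ~ used_edge u2 v2 /\ used_edge u3 v3) \/
  (~ used_edge u1 v1 /\ used_edge u2 v2 /\ used_edge u3 v3) ->
  exact2 (used_bit u1 v1) (used_bit u2 v2) (used_bit u3 v3) = true.
Proof.
  unfold used_bit, used_edge, exact2.
  destruct (excluded_middle_informative (used vert gadj C u1 v1));
  destruct (excluded_middle_informative (used vert gadj C u2 v2));
  destruct (excluded_middle_informative (used vert gadj C u3 v3)); simpl; tauto.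
Qed.

(** An end is governed by the levels far out on its side, where [X] is constant; one sample vertex
    there decides which side of the cut the end belongs to. *)
Lemma tame_ends k (X : vert -> Prop) :
  (forall u v, (k < lev u)%Z -> (k < lev v)%Z -> X u -> X v) ->
  (forall u v, (lev u < k)%Z -> (lev v < k)%Z -> X u -> X v) ->
  forall E, is_end vert gadj E -> C (PEnd vert E) ->
  cut_side vert gadj X (PEnd vert E) \/ cut_side vert gadj (fun v => ~ X v) (PEnd vert E).
Proof.
  intros Hr Hl E HE _. destruct (end_cases E HE) as (sg & Hsg & ->).
  set (x := ((sg * (Z.abs k + 1))%Z, w0) : vert).
  assert (Hx : lev x = (sg * (Z.abs k + 1))%Z) by reflexivity.
  destruct (excluded_middle_informative (X x)) as [Xx|Xx]; [left|right];
    apply (cut_side_end sg (Z.abs k)); auto; intros v Hv; [|intro Xv; apply Xx; revert Xv];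
    destruct Hsg as [->| ->];
    solve [apply (Hr x v); auto; lia | apply (Hl x v); auto; lia
          | apply (Hr v x); auto; lia | apply (Hl v x); auto; lia].
Qed.

Lemma vertex_uses_two v :
  match nbrs v with
  | [a; b; c] => exact2 (used_bit v a) (used_bit v b) (used_bit v c) = true
  | _ => False
  end.
Proof.
  assert (Hn : exists a b c, nbrs v = [a; b; c] /\ a <> b /\ a <> c /\ b <> c).
  { destruct v as [k i]. destruct i; simpl; do 3 eexists; (split; [reflexivity|]);
      repeat split; intro E; try discriminate E; injection E; lia. }
  destruct Hn as (a & b & c & Hn & N1 & N2 & N3). rewrite Hn.
  assert (Ha : forall x, gadj v x <-> x = a \/ x = b \/ x = c).
  { intro x. unfold gadj. rewrite Hn. simpl. intuition. }
  assert (Nv : forall x, gadj v x -> x <> v).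
  { intros x Hx ->. exact (gadj_irrefl _ Hx). }
  apply exact2_used.
  apply (three_cut_uses_two vert gadj gadj_sym gadj_irrefl vert_infinite C C_hamilton (fun x => x = v));
    try (apply Ha; tauto); try (apply Nv; apply Ha; tauto); auto; try congruence.
  - apply (tame_ends (lev v)); intros u w Hu Hw ->; lia.
  - intros u w Huw -> Hw. apply Ha in Huw. destruct Huw as [->|[->| ->]]; auto.
Qed.

Lemma level_uses_two k :
  exact2 (used_bit ((k - 1)%Z, w0) (k, w0)) (used_bit ((k - 1)%Z, w9) (k, w1))
         (used_bit ((k - 1)%Z, w4) (k, w5)) = true.
Proof.
  apply exact2_used.
  apply (three_cut_uses_two vert gadj gadj_sym gadj_irrefl vert_infinite C C_hamilton (fun x => (lev x < k)%Z));
    try (unfold lev; cbn [fst]; lia); try congruence.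
  - apply (tame_ends k); intros u w Hu Hw; lia.
  - unfold gadj; simpl. right; left; vert_eq.
  - unfold gadj; simpl. right; left; vert_eq.
  - unfold gadj; simpl. right; right; left; vert_eq.
  - apply level_cut.
Qed.

Definition piece_bits (k : Z) : list bool :=
  map (fun p => used_bit (fst p) (snd p)) (piece_edges k).

Lemma piece_degrees k : degrees_ok (piece_bits k) = true.
Proof.
  pose proof (level_uses_two k) as HL.
  pose proof (level_uses_two (k + 1)) as HR. replace (k + 1 - 1)%Z with k in HR by lia.
  apply forallb_forall. intros t Ht. unfold incident in Ht. simpl in Ht.
  repeat destruct Ht as [<-|Ht]; try contradiction; unfold bit, piece_bits; cbn [nth map piece_edges fst snd];
    [exact HL|exact HR| | | | | | | | | |];
    [ pose proof (vertex_uses_two (k, w0)) as H | pose proof (vertex_uses_two (k, w1)) as H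
    | pose proof (vertex_uses_two (k, w2)) as H | pose proof (vertex_uses_two (k, w3)) as H
    | pose proof (vertex_uses_two (k, w4)) as H | pose proof (vertex_uses_two (k, w5)) as H
    | pose proof (vertex_uses_two (k, w6)) as H | pose proof (vertex_uses_two (k, w7)) as H
    | pose proof (vertex_uses_two (k, w8)) as H | pose proof (vertex_uses_two (k, w9)) as H ];
    cbn [nbrs fst snd] in H;
    (* The vertex lists its edges starting at itself, while [piece_edges] fixes one orientation for
       each edge. *)
    match type of H with exact2 ?a ?b ?c = true =>
      match goal with |- exact2 ?a' ?b' ?c' = true =>
        replace a' with a by (first [reflexivity | apply used_bit_sym]);
        replace b' with b by (first [reflexivity | apply used_bit_sym]);
        replace c' with c by (first [reflexivity | apply used_bit_sym])
      end
    end; exact H.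
Qed.

Lemma loc_surj k n : (n < 12)%nat -> exists v, loc k v = n.
Proof.
  intro Hn.
  assert (H1 : (k - 1 <? k)%Z = true) by lia. assert (H2 : (k <? k)%Z = false) by lia.
  assert (H3 : (k + 1 <? k)%Z = false) by lia. assert (H4 : (k <? k + 1)%Z = true) by lia.
  destruct n as [|[|n]].
  - exists ((k - 1)%Z, w0). unfold loc, lev; cbn [fst]. rewrite H1. reflexivity.
  - exists ((k + 1)%Z, w0). unfold loc, lev; cbn [fst]. rewrite H3, H4. reflexivity.
  - exists (k, nth n [w0; w1; w2; w3; w4; w5; w6; w7; w8; w9] w0).
    unfold loc, lev; cbn [fst snd]. rewrite H2.
    do 10 (destruct n as [|n]; [reflexivity|]). lia.
Qed.

Lemma piece_crosses k c : In c sides -> crosses (piece_bits k) c = true.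
Proof.
  intro Hc.
  (* The colouring is pulled back to the whole graph along [loc]; being constant on either side of
     the piece, it satisfies [tame_ends]. *)
  set (X := fun v : vert => bit c (loc k v) = true).
  assert (Hne : exists u, X u).
  { unfold sides in Hc. apply filter_In in Hc. destruct Hc as [Hc Hex].
    apply existsb_exists in Hex. destruct Hex as (b & Hb & ->).
    apply (In_nth _ _ false) in Hb. destruct Hb as (n & Hn & E).
    assert (Hl : length c = 12%nat).
    { apply in_map_iff in Hc. destruct Hc as (c' & <- & Hc').
      assert (L : forall m e, In e (all_bits m) -> length e = m).
      { induction m; simpl; intros e He.
        - destruct He as [<-|[]]; auto.
        - apply in_app_or in He. destruct He as [He|He]; apply in_map_iff in He;
            destruct He as (e' & <- & He'); simpl; auto. }
      apply L in Hc'. simpl. destruct c'; simpl in *; lia. }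
    destruct (loc_surj k n) as (v & Hv); [lia|]. exists v. unfold X, bit. rewrite Hv. exact E. }
  destruct Hne as [u0 Xu0].
  assert (Hloc1 : forall v, (k < lev v)%Z -> loc k v = 1%nat).
  { intros v Hv. unfold loc. destruct (Z.ltb_spec (lev v) k), (Z.ltb_spec k (lev v)); auto; lia. }
  assert (Hloc0 : forall v, (lev v < k)%Z -> loc k v = 0%nat).
  { intros v Hv. unfold loc. destruct (Z.ltb_spec (lev v) k); auto; lia. }
  destruct (cut_not_avoided vert gadj gadj_sym gadj_irrefl vert_infinite C C_hamilton X)
    with (u0 := u0) (v0 := ((k + 1)%Z, w0) : vert) as (u & v & Huv & Xu & Xv); auto.
  - apply (tame_ends k); intros u w Hu Hw; unfold X.
    + rewrite !Hloc1 by auto. auto.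
    + rewrite !Hloc0 by auto. auto.
  - unfold X. rewrite Hloc1 by (unfold lev; cbn [fst]; lia). rewrite bit_sides_right; auto.
  - unfold X in Xu, Xv. apply not_true_is_false in Xv.
    assert (Hne : loc k u <> loc k v) by congruence.
    unfold crosses. rewrite <- (piece_edges_loc k). unfold piece_bits.
    apply existsb_exists.
    destruct (piece_edges_complete k u v (proj1 Huv) Hne) as [Hin|Hin];
      eexists; (split; [apply in_combine_map; exact Hin|]); cbn [fst snd].
    + rewrite (proj2 (used_bit_spec u v) Huv), Xu, Xv. reflexivity.
    + rewrite used_bit_sym, (proj2 (used_bit_spec u v) Huv), Xu, Xv. reflexivity.
Qed.

Lemma piece_bits_eq k : piece_bits k = ham_bits.
Proof.
  assert (F : forall m, bit (piece_bits m) 1 = true /\ bit (piece_bits m) 3 = true /\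
     (bit (piece_bits m) 2 = false -> bit (piece_bits m) 5 = false -> piece_bits m = ham_bits)).
  { intro m. apply piece_forced; auto using piece_degrees, piece_crosses. }
  assert (L : forall m, used_bit ((m - 1)%Z, w4) (m, w5) = false).
  { intro m. destruct (F m) as (F1 & _ & _). destruct (F (m - 1)%Z) as (_ & F3 & _).
    pose proof (level_uses_two m) as H.
    unfold bit, piece_bits in F1, F3. cbn [nth map piece_edges fst snd] in F1, F3.
    replace (m - 1 + 1)%Z with m in F3 by lia. rewrite F1, F3 in H. simpl in H.
    destruct (used_bit ((m - 1)%Z, w4) (m, w5)); auto; discriminate. }
  apply F.
  - exact (L k).
  - pose proof (L (k + 1)%Z) as H. replace (k + 1 - 1)%Z with k in H by lia. exact H.
Qed.

End PieceUniqueness.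

(** * The Hamilton circle *)

Lemma dist2_lt_coords x y x' y' eps : 0 < eps -> dist2 (x, y) (x', y') < eps ->
  - eps < x' - x < eps /\ - eps < y' - y < eps.
Proof.
  intros He H. apply dist2_lt in H; auto. cbn [fst snd] in H.
  pose proof (pow2_ge_0 (x - x')). pose proof (pow2_ge_0 (y - y')). split; split; nra.
Qed.

Lemma S1_bounds x y : S1 (x, y) -> -1 <= x <= 1 /\ Rabs y <= 1 /\ x^2 + (Rabs y)^2 = 1.
Proof.
  unfold S1. cbn [fst snd]. intro H. rewrite pow2_abs.
  assert (-1 <= x <= 1) by (split; nra). split; auto. split; auto. apply Rabs_le. split; nra.
Qed.

(** The numerator x'a - xa' equals (x' - x)a - x(a' - a), which is below 2 [eps] in absolute value
    because [a] and |x| are at most 1. *)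
Lemma slope_continuous x y delta : S1 (x, y) -> y <> 0 -> 0 < delta ->
  exists eps, 0 < eps /\ forall x' y', S1 (x', y') -> dist2 (x, y) (x', y') < eps ->
    0 < y * y' /\ Rabs (x' / Rabs y' - x / Rabs y) < delta.
Proof.
  intros H Hy Hd. destruct (S1_bounds x y H) as (Hx & Ha & Hxa).
  assert (Hapos : 0 < Rabs y) by (apply Rabs_pos_lt; auto).
  set (a := Rabs y) in *.
  (* The first bound gives a' >= a / 2 and prevents a change of half circle; the second then gives 2
     [eps] <= [delta] a a'. *)
  set (eps := Rmin (a / 2) (delta * a^2 / 4)).
  assert (He1 : eps <= a / 2) by apply Rmin_l.
  assert (He2 : eps <= delta * a^2 / 4) by apply Rmin_r.
  assert (Ha2 : 0 < a^2) by nra.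
  assert (He : 0 < eps) by (apply Rmin_pos; nra).
  exists eps. split; auto. intros x' y' H' Hdist.
  apply dist2_lt_coords in Hdist; auto. destruct Hdist as [Dx Dy].
  assert (Hs : 0 < y * y' /\ - eps < Rabs y' - a < eps).
  { unfold a in *. revert Dy He1 Hapos. unfold Rabs. destruct (Rcase_abs y), (Rcase_abs y'); intros; split; nra. }
  destruct Hs as [Hs Da]. split; auto.
  set (a' := Rabs y') in *. assert (Ha' : a / 2 <= a') by lra.
  assert (Haa : 0 < a * a') by nra.
  replace (x' / a' - x / a) with ((x' * a - x * a') / (a * a')) by (field; split; lra).
  assert (N : - (2 * eps) < x' * a - x * a' < 2 * eps).
  { replace (x' * a - x * a') with ((x' - x) * a - x * (a' - a)) by ring. split; nra. }
  assert (B : 2 * eps <= delta * (a * a')) by nra.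
  apply Rabs_def1.
  - apply Rmult_lt_reg_r with (a * a'); auto.
    replace ((x' * a - x * a') / (a * a') * (a * a')) with (x' * a - x * a') by (field; split; lra). lra.
  - apply Rmult_lt_reg_r with (a * a'); auto.
    replace ((x' * a - x * a') / (a * a') * (a * a')) with (x' * a - x * a') by (field; split; lra). lra.
Qed.

(** The squared distance is 2 - 2 [dot], and [dot]^2 + [cr]^2 = 1 with |[cr]| <= |s' - s|. Slopes at
    distance below 1 keep [dot] nonnegative, which rules out nearly antipodal points; then 1 - [dot]
    <= [cr]^2. *)
Lemma slope_inverse_continuous x y eps : S1 (x, y) -> y <> 0 -> 0 < eps ->
  exists delta, 0 < delta /\ forall x' y', S1 (x', y') -> 0 < y * y' ->
    Rabs (x' / Rabs y' - x / Rabs y) < delta -> dist2 (x, y) (x', y') < eps.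
Proof.
  intros H Hy He. destruct (S1_bounds x y H) as (Hx & Ha & Hxa).
  assert (Hapos : 0 < Rabs y) by (apply Rabs_pos_lt; auto).
  exists (Rmin 1 (eps / 2)). split. { apply Rmin_pos; lra. }
  intros x' y' H' Hyy Hs. destruct (S1_bounds x' y' H') as (Hx' & Ha' & Hxa').
  assert (Hapos' : 0 < Rabs y'). { apply Rabs_pos_lt. intros ->. lra. }
  apply dist2_lt; auto. cbn [fst snd].
  replace ((y - y')^2) with ((Rabs y - Rabs y')^2).
  2:{ unfold Rabs. destruct (Rcase_abs y), (Rcase_abs y'); nra. }
  set (a := Rabs y) in *. set (a' := Rabs y') in *.
  pose proof (Rmin_l 1 (eps / 2)). pose proof (Rmin_r 1 (eps / 2)).
  apply Rabs_def2 in Hs.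
  set (s := x / a) in *. set (s' := x' / a') in *.
  assert (Ex : x = s * a) by (unfold s; field; lra).
  assert (Ex' : x' = s' * a') by (unfold s'; field; lra).
  assert (Haa : 0 < a * a' <= 1) by (split; nra).
  set (dot := x * x' + a * a').
  assert (Hdot : 0 <= dot).
  { unfold dot. rewrite Ex, Ex'. replace (s * a * (s' * a') + a * a') with ((a * a') * (1 + s * s')) by ring.
    apply Rmult_le_pos; [lra|]. destruct (Rle_dec 0 s); nra. }
  assert (Hcross : dot^2 + ((a * a') * (s' - s))^2 = 1).
  { transitivity ((x^2 + a^2) * (x'^2 + a'^2)); [|rewrite Hxa, Hxa'; ring].
    unfold dot. rewrite Ex, Ex'. ring. }
  set (cr := (a * a') * (s' - s)) in *.
  assert (Hcr : cr^2 <= (s' - s)^2).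
  { unfold cr. rewrite Rpow_mult_distr. pose proof (pow2_ge_0 (s' - s)).
    assert ((a * a')^2 <= 1) by nra. nra. }
  assert (Hd1 : dot <= 1) by nra.
  assert (Hd2 : 1 - dot <= cr^2) by nra.
  assert (Hs2 : (s' - s)^2 < (eps / 2)^2) by nra.
  replace ((x - x')^2 + (a - a')^2) with (2 - 2 * dot).
  2:{ unfold dot. nra. }
  nra.
Qed.

Lemma slope_near_end sg K : sg = 1 \/ sg = -1 -> 0 <= K ->
  exists eps, 0 < eps /\ forall x y, S1 (x, y) -> dist2 (sg, 0) (x, y) < eps ->
    0 < sg * x /\ (y <> 0 -> K < sg * (x / Rabs y)).
Proof.
  (* This makes |y| < 1 / (2(K + 1)) while [sg] x >= 1/2, so the slope exceeds K. *)
  intros Hsg HK. set (eps := / (2 * (K + 1))).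
  assert (He : 0 < eps) by (apply Rinv_0_lt_compat; lra).
  assert (HeK : eps * (K + 1) = 1 / 2) by (unfold eps; field; lra).
  assert (He1 : eps <= 1 / 2) by nra.
  exists eps. split; auto. intros x y H Hd. apply dist2_lt_coords in Hd; auto. destruct Hd as [Dx Dy].
  assert (Hx : 1 / 2 <= sg * x) by (destruct Hsg; subst; lra).
  split; [lra|]. intro Hy.
  assert (Hapos : 0 < Rabs y) by (apply Rabs_pos_lt; auto).
  assert (Ha : Rabs y < eps) by (apply Rabs_def1; lra).
  apply Rmult_lt_reg_r with (Rabs y); auto.
  replace (sg * (x / Rabs y) * Rabs y) with (sg * x) by (field; lra). nra.
Qed.

Lemma slope_near_end_inv sg eps : sg = 1 \/ sg = -1 -> 0 < eps ->
  exists K, 0 <= K /\ forall x y, S1 (x, y) -> y <> 0 -> K < sg * (x / Rabs y) -> dist2 (sg, 0) (x, y) < eps.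
Proof.
  intros Hsg He. exists (2 / eps).
  assert (HK : 0 < 2 / eps) by (apply Rdiv_lt_0_compat; lra).
  split; [lra|]. intros x y H Hy Hs.
  assert (Hapos : 0 < Rabs y) by (apply Rabs_pos_lt; auto).
  destruct (S1_bounds x y H) as (Hx & Ha & Hxa).
  apply Rmult_lt_compat_r with (r := Rabs y * eps) in Hs; [|nra].
  replace (2 / eps * (Rabs y * eps)) with (2 * Rabs y) in Hs by (field; lra).
  replace (sg * (x / Rabs y) * (Rabs y * eps)) with (sg * x * eps) in Hs by (field; lra).
  apply dist2_lt; auto. cbn [fst snd].
  unfold S1 in H. cbn [fst snd] in H.
  set (X := sg * x) in *. assert (HX : X <= 1) by (unfold X; destruct Hsg; subst; lra).
  assert (HX0 : 0 < X) by nra.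
  replace ((sg - x)^2 + (0 - y)^2) with (2 - 2 * X).
  2:{ unfold X. destruct Hsg; subst; nra. }
  assert (HX2 : X^2 = x^2) by (unfold X; destruct Hsg; subst; ring).
  assert (1 - X <= (Rabs y)^2) by nra. nra.
Qed.

(** * The two spanning double rays as lines *)

Lemma floor_ex s : exists m : Z, IZR m <= s < IZR m + 1.
Proof. exists (Int_part s). destruct (base_Int_part s). lra. Qed.

Definition bot_idx (r : Z) : idx := nth (Z.to_nat r) [w1; w2; w3; w4; w5; w6; w7; w8; w9] w1.

(** The integer [m] counts vertices along the double ray: one per piece for the [w0], nine per piece
    for the other, so quotient and remainder by 9 give piece and position. *)
Definition dray (b : bool) (m : Z) : vert :=
  if b then (m, w0) else ((m / 9)%Z, bot_idx (m mod 9)).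

Lemma dray_bot q r : (0 <= r < 9)%Z -> dray false (9 * q + r) = (q, bot_idx r).
Proof.
  intro Hr. unfold dray. f_equal.
  - symmetry. apply Z.div_unique with r; lia.
  - f_equal. symmetry. apply Z.mod_unique with q; lia.
Qed.

Ltac cases9 r := assert (r = 0 \/ r = 1 \/ r = 2 \/ r = 3 \/ r = 4 \/ r = 5 \/ r = 6 \/ r = 7 \/ r = 8)%Z
    as Hcases by lia; repeat destruct Hcases as [Hcases|Hcases]; subst r.

Lemma bot_form m : exists q r, (0 <= r < 9)%Z /\ m = (9 * q + r)%Z.
Proof.
  exists (m / 9)%Z, (m mod 9)%Z. split; [apply Z.mod_pos_bound; lia|apply Z.div_mod; lia].
Qed.

Lemma dray_adj b m : gadj (dray b m) (dray b (m + 1)).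
Proof.
  destruct b. { unfold dray, gadj; simpl; auto. }
  destruct (bot_form m) as (q & r & Hr & ->). rewrite dray_bot by auto.
  destruct (Z.eq_dec r 8) as [->|N].
  - replace (9 * q + 8 + 1)%Z with (9 * (q + 1) + 0)%Z by lia. rewrite dray_bot by lia.
    unfold gadj; simpl; auto.
  - rewrite <- Z.add_assoc. rewrite dray_bot by lia.
    cases9 r; try lia; unfold gadj; simpl; auto.
Qed.

Lemma dray_inj b m b' m' : dray b m = dray b' m' -> b = b' /\ m = m'.
Proof.
  destruct (bot_form m) as (q & r & Hr & Em). destruct (bot_form m') as (q' & r' & Hr' & Em').
  destruct b, b'; intro E.
  - injection E as ->. auto.
  - rewrite Em', dray_bot in E by auto. exfalso. cases9 r'; discriminate E.
  - rewrite Em, dray_bot in E by auto. exfalso. cases9 r; discriminate E.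
  - rewrite Em, Em', !dray_bot in E by auto. split; auto. injection E as -> E.
    assert (r = r'); [|lia]. cases9 r; cases9 r'; try reflexivity; discriminate E.
Qed.

Lemma dray_surj v : exists b m, dray b m = v.
Proof.
  destruct v as [k i].
  assert (H : i = w0 \/ exists r, (0 <= r < 9)%Z /\ bot_idx r = i).
  { destruct i; auto; right;
      [exists 0%Z|exists 1%Z|exists 2%Z|exists 3%Z|exists 4%Z|exists 5%Z|exists 6%Z|exists 7%Z|exists 8%Z];
      split; try reflexivity; lia. }
  destruct H as [->|(r & Hr & <-)].
  - exists true, k. reflexivity.
  - exists false, (9 * k + r)%Z. apply dray_bot; auto.
Qed.

Lemma dray_mono b m m' : (m <= m')%Z -> (lev (dray b m) <= lev (dray b m'))%Z.
Proof. intro H. destruct b; unfold lev, dray; cbn [fst]; auto. apply Z.div_le_mono; lia. Qed.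

Lemma dray_lev b k : exists m, lev (dray b m) = k.
Proof.
  destruct b; [exists k; reflexivity|]. exists (9 * k + 0)%Z. rewrite dray_bot by lia. reflexivity.
Qed.

Lemma dray_far sg K : is_sign sg -> exists M, forall b m, (M <= sg * m)%Z -> (K < sg * lev (dray b m))%Z.
Proof.
  intro Hsg. destruct (dray_lev true (sg * (K + 1))) as [m1 H1]. destruct (dray_lev false (sg * (K + 1))) as [m2 H2].
  exists (Z.max (sg * m1) (sg * m2)). intros b m Hm.
  destruct b; destruct Hsg as [->| ->].
  - pose proof (dray_mono true m1 m). lia.
  - pose proof (dray_mono true m m1). lia.
  - pose proof (dray_mono false m2 m). lia.
  - pose proof (dray_mono false m m2). lia.
Qed.

Lemma dray_far_inv sg M : is_sign sg -> exists K, forall b m, (K < sg * lev (dray b m))%Z -> (M < sg * m)%Z.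
Proof.
  intro Hsg. exists (Z.max (sg * lev (dray true (sg * M))) (sg * lev (dray false (sg * M)))).
  intros b m Hm. destruct (Z_lt_ge_dec M (sg * m)) as [|L]; auto. exfalso.
  destruct b; destruct Hsg as [->| ->].
  - pose proof (dray_mono true m (1 * M)). lia.
  - pose proof (dray_mono true (-1 * M) m). lia.
  - pose proof (dray_mono false m (1 * M)). lia.
  - pose proof (dray_mono false (-1 * M) m). lia.
Qed.

Lemma dray_ne b m : dray b m <> dray b (m + 1).
Proof. intro E. apply dray_inj in E. lia. Qed.

Definition dray_pt (b : bool) (s : R) : point vert :=
  ept vert (dray b (Int_part s)) (dray b (Int_part s + 1)) (s - IZR (Int_part s)).

(** The right end point is included: there the integer part is already m + 1, but the start of the
    next edge is the same point as the end of this one. *)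
Lemma dray_pt_eq b m s : IZR m <= s <= IZR m + 1 ->
  dray_pt b s = ept vert (dray b m) (dray b (m + 1)) (s - IZR m).
Proof.
  intro Hs. unfold dray_pt. destruct (base_Int_part s) as [H1 H2]. set (n := Int_part s) in *.
  destruct (Req_dec s (IZR m + 1)) as [E|N].
  - assert (n = m + 1)%Z as ->.
    { apply Z.le_antisymm; apply Z.lt_succ_r; apply lt_IZR; rewrite succ_IZR, ?plus_IZR; lra. }
    rewrite plus_IZR. replace (s - (IZR m + 1)) with 0 by lra. replace (s - IZR m) with 1 by lra.
    rewrite ept_0, ept_1; auto using dray_ne.
  - assert (n = m) as ->; auto.
    apply Z.le_antisymm; apply Z.lt_succ_r; apply lt_IZR; rewrite succ_IZR; lra.
Qed.

Lemma dray_pt_int b m : dray_pt b (IZR m) = vtx vert (dray b m).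
Proof.
  rewrite (dray_pt_eq b m) by lra. replace (IZR m - IZR m) with 0 by ring.
  apply ept_0. apply dray_ne.
Qed.

Lemma dray_pt_inj b s b' s' : dray_pt b s = dray_pt b' s' -> b = b' /\ s = s'.
Proof.
  intro E. destruct (floor_ex s) as [m Hm]. destruct (floor_ex s') as [m' Hm'].
  destruct (Req_dec s (IZR m)) as [->|N]; destruct (Req_dec s' (IZR m')) as [->|N'].
  - rewrite !dray_pt_int in E. apply vtx_inj in E. apply dray_inj in E. destruct E; subst; auto.
  - exfalso. rewrite dray_pt_int, (dray_pt_eq b' m') in E by lra.
    revert E. apply vtx_neq_ept; [apply dray_ne|lra].
  - exfalso. rewrite dray_pt_int, (dray_pt_eq b m) in E by lra.
    symmetry in E. revert E. apply vtx_neq_ept; [apply dray_ne|lra].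
  - rewrite (dray_pt_eq b m), (dray_pt_eq b' m') in E by lra.
    apply ept_inj in E; auto using dray_ne; try lra.
    destruct E as [(E1 & E2 & E3)|(E1 & E2 & E3)]; apply dray_inj in E1; apply dray_inj in E2.
    + destruct E1; subst. split; auto; lra.
    + lia.
Qed.

Lemma dray_pt_inG b s : inG vert gadj (dray_pt b s).
Proof.
  destruct (floor_ex s) as [m Hm]. rewrite (dray_pt_eq b m) by lra.
  apply inG_ept; [apply dray_adj|lra].
Qed.

Lemma dray_pt_continuous O b s : open_G vert gadj O -> O (dray_pt b s) ->
  exists eps, 0 < eps /\ forall s', Rabs (s' - s) < eps -> O (dray_pt b s').
Proof.
  intros HO Hs. destruct (floor_ex s) as [m Hm]. destruct (Req_dec s (IZR m)) as [->|N].
  - rewrite dray_pt_int in Hs.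
    destruct (open_G_vertex vert gadj gadj_irrefl O _ HO Hs) as (eps & He & Hball).
    exists eps. split; [lra|]. intros s' Hs'. apply Rabs_def2 in Hs'.
    destruct (Rle_dec (IZR m) s').
    + rewrite (dray_pt_eq b m) by lra. apply Hball; [apply dray_adj|lra].
    + assert (Em : IZR (m - 1) = IZR m - 1) by (rewrite minus_IZR; lra).
      rewrite (dray_pt_eq b (m - 1)) by (rewrite Em; lra).
      rewrite ept_swap by apply dray_ne. replace (m - 1 + 1)%Z with m by lia.
      apply Hball.
      * apply gadj_sym. pose proof (dray_adj b (m - 1)) as A. replace (m - 1 + 1)%Z with m in A by lia. auto.
      * rewrite Em; lra.
  - rewrite (dray_pt_eq b m) in Hs by lra.
    assert (Ht : 0 < s - IZR m < 1) by lra.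
    destruct (open_G_edge vert gadj gadj_irrefl O _ _ _ HO (dray_adj b m) Ht Hs) as (eps & He & Hball).
    exists eps. split; auto. intros s' Hs'.
    destruct (Hball (s' - IZR m)) as [Hr HOs].
    { replace (s' - IZR m - (s - IZR m)) with (s' - s) by ring. auto. }
    rewrite (dray_pt_eq b m) by lra. auto.
Qed.

(** Around a vertex the star also contains part of the third edge, but [ept_inj] shows that its
    inner points in the image come only from the two edges of the double ray. Excluding the ends
    keeps (1, 0) and (-1, 0) out of the preimage under [ham_map]. *)
Lemma dray_pt_embedding b s delta : 0 < delta ->
  exists O, open_G vert gadj O /\ O (dray_pt b s) /\ (forall E, ~ O (PEnd vert E)) /\
    forall b' s', O (dray_pt b' s') -> b' = b /\ Rabs (s' - s) < delta.
Proof.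
  intro Hd. destruct (floor_ex s) as [m Hm]. destruct (Req_dec s (IZR m)) as [->|N].
  - pose proof (Rmin_l 1 delta). pose proof (Rmin_r 1 delta).
    assert (He : 0 < Rmin 1 delta) by (apply Rmin_pos; lra).
    exists (star vert gadj (dray b m) (Rmin 1 delta)). repeat split.
    + apply star_open; lra.
    + left. apply dray_pt_int.
    + intros E [H'|(u & t & _ & _ & H')]; discriminate H'.
    + destruct H1 as [E|(u & t & Hu & Ht & E)].
      * rewrite <- dray_pt_int in E. apply dray_pt_inj in E. tauto.
      * destruct (floor_ex s') as [m' Hm']. rewrite (dray_pt_eq b' m') in E by lra. symmetry in E.
        apply ept_inj in E; [|apply (adj_neq vert gadj gadj_irrefl); auto|apply dray_ne|lra|lra].
        destruct E as [(E1 & _)|(E1 & _)]; apply dray_inj in E1; symmetry; tauto.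
    + destruct H1 as [E|(u & t & Hu & Ht & E)].
      * rewrite <- dray_pt_int in E. apply dray_pt_inj in E. destruct E as [_ ->].
        rewrite Rminus_diag, Rabs_R0. auto.
      * destruct (floor_ex s') as [m' Hm']. rewrite (dray_pt_eq b' m') in E by lra. symmetry in E.
        apply ept_inj in E; [|apply (adj_neq vert gadj gadj_irrefl); auto|apply dray_ne|lra|lra].
        destruct E as [(E1 & _ & E3)|(E1 & _ & E3)]; apply dray_inj in E1; destruct E1 as [_ ->].
        -- apply Rabs_def1; lra.
        -- rewrite plus_IZR. apply Rabs_def1; lra.
  - set (t := s - IZR m).
    pose proof (Rmax_l 0 (t - delta)). pose proof (Rmax_r 0 (t - delta)).
    pose proof (Rmin_l 1 (t + delta)). pose proof (Rmin_r 1 (t + delta)).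
    assert (Rmax 0 (t - delta) < t) by (apply Rmax_lub_lt; unfold t; lra).
    assert (t < Rmin 1 (t + delta)) by (apply Rmin_glb_lt; unfold t; lra).
    exists (edge_seg vert (dray b m) (dray b (m + 1)) (Rmax 0 (t - delta)) (Rmin 1 (t + delta))).
    split; [|split; [|split]].
    + apply edge_seg_open; auto. apply dray_adj.
    + exists t. split; auto. apply dray_pt_eq. lra.
    + intros E (t' & _ & H'). discriminate H'.
    + intros b' s' (t' & Ht' & E).
      replace t' with ((IZR m + t') - IZR m) in E by ring. rewrite <- dray_pt_eq in E by lra.
      apply dray_pt_inj in E. destruct E as [-> ->]. split; auto. unfold t in *.
      apply Rabs_def1; lra.
Qed.

(** * The homeomorphism from the unit circle *)

Definition pos_b (y : R) : bool := if Rlt_dec 0 y then true else false.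

Definition ham_map (z : R * R) : point vert :=
  if Req_dec_T (snd z) 0 then
    if Rlt_dec 0 (fst z) then PEnd vert (the_end 1) else PEnd vert (the_end (-1))
  else dray_pt (pos_b (snd z)) (fst z / Rabs (snd z)).

Lemma the_end_inj sg sg' : is_sign sg -> is_sign sg' -> the_end sg = the_end sg' -> sg = sg'.
Proof.
  intros Hsg Hsg' E. destruct (the_end_three_rays sg Hsg) as (rs & H & _).
  specialize (H 0%nat). assert (H1 : the_end sg (rs 0%nat)) by (apply H; lia).
  assert (H2 : the_end sg' (rs 0%nat)) by (rewrite <- E; auto).
  destruct H1 as [_ H1]. destruct H2 as [_ H2].
  destruct (H1 0%Z) as [N1 HN1]. destruct (H2 0%Z) as [N2 HN2].
  specialize (HN1 (Nat.max N1 N2)). specialize (HN2 (Nat.max N1 N2)).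
  destruct Hsg as [->| ->], Hsg' as [->| ->]; auto; lia.
Qed.

Lemma IZR_sign sg : is_sign sg -> IZR sg = 1 \/ IZR sg = -1.
Proof. intros [->| ->]; auto. Qed.

Lemma ham_map_end sg : is_sign sg -> ham_map (IZR sg, 0) = PEnd vert (the_end sg).
Proof.
  intro Hsg. unfold ham_map. cbn [fst snd]. destruct (Req_dec_T 0 0); [|lra].
  destruct Hsg as [->| ->]; destruct (Rlt_dec 0 _); auto; lra.
Qed.

Lemma ham_map_ray x y : y <> 0 -> ham_map (x, y) = dray_pt (pos_b y) (x / Rabs y).
Proof.
  intro Hy. unfold ham_map, pos_b. cbn [fst snd]. destruct (Req_dec_T y 0); [contradiction|auto].
Qed.

Lemma S1_cases x y : S1 (x, y) -> (exists sg, is_sign sg /\ x = IZR sg /\ y = 0) \/ y <> 0.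
Proof.
  intro H. destruct (Req_dec y 0) as [->|]; auto. left. unfold S1 in H. cbn [fst snd] in H.
  assert (E : (x - 1) * (x + 1) = 0) by lra.
  apply Rmult_integral in E. destruct E as [E|E].
  - exists 1%Z. repeat split. { left; auto. } lra.
  - exists (-1)%Z. repeat split. { right; auto. } lra.
Qed.

Lemma pos_b_same y y' : y <> 0 -> y' <> 0 -> (pos_b y = pos_b y' <-> 0 < y * y').
Proof.
  intros Hy Hy'. unfold pos_b. destruct (Rlt_dec 0 y), (Rlt_dec 0 y'); split; intro; auto; try nra; discriminate.
Qed.

Lemma ham_map_onto_ray b s : exists z, S1 z /\ ham_map z = dray_pt b s.
Proof.
  set (n := sqrt (1 + s^2)).
  assert (Hn2 : n^2 = 1 + s^2). { unfold n. rewrite pow2_sqrt; auto. nra. }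
  assert (Hn : 0 < n). { apply sqrt_lt_R0. nra. }
  (* The point (s, 1) or (s, -1) scaled to norm one, as the slope is invariant under positive
     scaling. *)
  exists (s / n, if b then 1 / n else - (1 / n)).
  assert (Hi : 0 < 1 / n) by (apply Rdiv_lt_0_compat; lra).
  split.
  - unfold S1. cbn [fst snd]. replace ((if b then 1 / n else - (1 / n))^2) with ((1 / n)^2) by (destruct b; ring).
    transitivity ((1 + s^2) / n^2); [field; lra|]. rewrite <- Hn2. field. nra.
  - rewrite ham_map_ray by (destruct b; lra). f_equal.
    + unfold pos_b. destruct b; destruct (Rlt_dec 0 _); auto; lra.
    + replace (Rabs (if b then 1 / n else - (1 / n))) with (1 / n).
      * field. lra.
      * destruct b; rewrite ?Rabs_Ropp; rewrite Rabs_pos_eq; lra.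
Qed.

Lemma S1_sign sg : is_sign sg -> S1 (IZR sg, 0).
Proof. intros [->| ->]; unfold S1; cbn [fst snd]; lra. Qed.

Lemma ham_map_inj z z' : S1 z -> S1 z' -> ham_map z = ham_map z' -> z = z'.
Proof.
  destruct z as [x y], z' as [x' y']. intros H H' E.
  destruct (S1_cases x y H) as [(sg & Hsg & -> & ->)|Hy];
  destruct (S1_cases x' y' H') as [(sg' & Hsg' & -> & ->)|Hy'].
  - rewrite !ham_map_end in E by auto. injection E as E. apply the_end_inj in E; auto. congruence.
  - rewrite ham_map_end, ham_map_ray in E by auto. discriminate E.
  - rewrite ham_map_end, ham_map_ray in E by auto. discriminate E.
  - rewrite !ham_map_ray in E by auto. apply dray_pt_inj in E. destruct E as [Eb Es].
    apply pos_b_same in Eb; auto.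
    assert (Ha : 0 < Rabs y) by (apply Rabs_pos_lt; auto).
    assert (Ha' : 0 < Rabs y') by (apply Rabs_pos_lt; auto).
    destruct (S1_bounds x y H) as (_ & _ & Hxa). destruct (S1_bounds x' y' H') as (_ & _ & Hxa').
    set (s := x / Rabs y) in *.
    assert (Ex : x = s * Rabs y) by (unfold s; field; lra).
    assert (Ex' : x' = s * Rabs y') by (rewrite Es; field; lra).
    assert (Eq : (Rabs y - Rabs y') * ((s^2 + 1) * (Rabs y + Rabs y')) = 0).
    { transitivity ((x^2 + Rabs y^2) - (x'^2 + Rabs y'^2)); [rewrite Ex, Ex' at 1; ring|lra]. }
    apply Rmult_integral in Eq. destruct Eq as [Eq|Eq]; [|nra].
    assert (Ea : Rabs y = Rabs y') by lra.
    f_equal.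
    + rewrite Ex, Ex', Ea. auto.
    + revert Ea. unfold Rabs. destruct (Rcase_abs y), (Rcase_abs y'); intros; nra.
Qed.

Lemma ham_map_inG z : S1 z -> inG vert gadj (ham_map z).
Proof.
  destruct z as [x y]. intro H. destruct (S1_cases x y H) as [(sg & Hsg & -> & ->)|Hy].
  - rewrite ham_map_end by auto. right. right. exists (the_end sg). split; auto. apply the_end_is_end; auto.
  - rewrite ham_map_ray by auto. apply dray_pt_inG.
Qed.

Lemma ham_map_continuous O z : open_G vert gadj O -> S1 z -> O (ham_map z) ->
  exists eps, 0 < eps /\ forall z', S1 z' -> dist2 z z' < eps -> O (ham_map z').
Proof.
  intros HO Hz Oz. destruct z as [x y].
  destruct (S1_cases x y Hz) as [(sg & Hsg & -> & ->)|Hy].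
  - rewrite ham_map_end in Oz by auto.
    destruct (open_G_end vert gadj O _ HO (the_end_is_end sg Hsg) Oz) as [S HS].
    destruct (in_comp_far sg S Hsg) as [K HK]. destruct (dray_far sg K Hsg) as [M HM].
    (* The extra 1 compensates for rounding the slope down to the integer [m]. *)
    destruct (slope_near_end (IZR sg) (IZR (Z.abs M) + 1) (IZR_sign sg Hsg)) as (eps & He & Hball).
    { assert (0 <= IZR (Z.abs M)) by (apply IZR_le; lia). lra. }
    exists eps. split; auto. intros [x' y'] Hz' Hd.
    destruct (Hball x' y' Hz' Hd) as [Hx' Hs'].
    destruct (S1_cases x' y' Hz') as [(sg' & Hsg' & -> & ->)|Hy'].
    + assert (sg' = sg) as ->. { destruct Hsg as [->| ->], Hsg' as [->| ->]; auto; exfalso; lra. }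
      rewrite ham_map_end; auto.
    + rewrite ham_map_ray by auto. specialize (Hs' Hy').
      set (s := x' / Rabs y') in *. destruct (floor_ex s) as [m Hm].
      rewrite (dray_pt_eq _ m) by lra. apply HS; [apply dray_adj| |lra].
      apply HK. apply HM. apply Z.le_trans with (Z.abs M); [lia|]. apply le_IZR. rewrite mult_IZR.
      destruct Hsg as [->| ->]; lra.
  - rewrite ham_map_ray in Oz by auto.
    destruct (dray_pt_continuous O _ _ HO Oz) as (delta & Hd & Hball).
    destruct (slope_continuous x y delta Hz Hy Hd) as (eps & He & Hball').
    exists eps. split; auto. intros [x' y'] Hz' Hdist.
    destruct (Hball' x' y' Hz' Hdist) as [Hyy Hs].
    assert (Hy' : y' <> 0) by (intros ->; lra).
    rewrite ham_map_ray by auto. replace (pos_b y') with (pos_b y). { auto. }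
    apply pos_b_same; auto.
Qed.

Lemma ham_map_inverse_continuous z eps : S1 z -> 0 < eps ->
  exists O, open_G vert gadj O /\ O (ham_map z) /\
    forall z', S1 z' -> O (ham_map z') -> dist2 z z' < eps.
Proof.
  intros Hz He. destruct z as [x y].
  destruct (S1_cases x y Hz) as [(sg & Hsg & -> & ->)|Hy].
  - destruct (slope_near_end_inv (IZR sg) eps (IZR_sign sg Hsg) He) as (B & HB & Hball).
    destruct (floor_ex B) as [n Hn].
    (* The margin 2 covers rounding [B] down to [n] and the fact that possibly only one end vertex
       of the edge containing the point lies in [X]. *)
    destruct (dray_far_inv sg (n + 2) Hsg) as [K HK].
    set (X := fun v => (K < sg * lev v)%Z).
    exists (cut_side vert gadj X). split; [|split].
    + apply cut_side_open; [apply gadj_sym|apply gadj_irrefl].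
    + rewrite ham_map_end by auto. apply (cut_side_end sg K); auto.
    + intros [x' y'] Hz' Ho. destruct (S1_cases x' y' Hz') as [(sg' & Hsg' & -> & ->)|Hy'].
      * rewrite ham_map_end in Ho by auto.
        destruct (Z.eq_dec sg' sg) as [->|N].
        { apply dist2_lt; auto. cbn [fst snd]. replace ((IZR sg - IZR sg)^2 + (0 - 0)^2) with 0 by ring. nra. }
        (* The opposite end lies on the complementary side of this cut. *)
        exfalso. apply (cut_side_disjoint vert gadj gadj_sym gadj_irrefl X (PEnd vert (the_end sg'))); auto.
        apply (cut_side_end sg' (- K)); auto. intros v Hv. unfold X.
        destruct Hsg as [->| ->], Hsg' as [->| ->]; lia.
      * apply Hball; auto. rewrite ham_map_ray in Ho by auto.
        set (s := x' / Rabs y') in *. destruct (floor_ex s) as [m Hm].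
        rewrite (dray_pt_eq _ m) in Ho by lra.
        apply cut_side_ept in Ho; [|apply gadj_irrefl|apply dray_adj|lra].
        assert (Hm' : (n + 2 < sg * m \/ n + 2 < sg * (m + 1))%Z).
        { destruct Ho as [Ho|Ho]; [left|right]; eapply HK; exact Ho. }
        assert (Hm2 : (n + 1 < sg * m)%Z) by (destruct Hsg as [->| ->]; lia).
        apply IZR_lt in Hm2. rewrite plus_IZR, mult_IZR in Hm2.
        assert (Hm3 : (n + 2 <= sg * m)%Z) by (destruct Hsg as [->| ->]; lia).
        apply IZR_le in Hm3. rewrite plus_IZR, mult_IZR in Hm3.
        destruct Hsg as [->| ->]; lra.
  - rewrite ham_map_ray by auto.
    destruct (slope_inverse_continuous x y eps Hz Hy He) as (delta & Hd & Hball).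
    destruct (dray_pt_embedding (pos_b y) (x / Rabs y) delta Hd) as (O & HO & HOs & HOe & HOb).
    exists O. split; auto. split; auto. intros [x' y'] Hz' Ho.
    destruct (S1_cases x' y' Hz') as [(sg' & Hsg' & -> & ->)|Hy'].
    + rewrite ham_map_end in Ho by auto. exfalso. eapply HOe; eauto.
    + rewrite ham_map_ray in Ho by auto. apply HOb in Ho. destruct Ho as [Eb Hs].
      apply Hball; auto. apply pos_b_same; auto.
Qed.

Definition ham_circle (p : point vert) : Prop := exists z, S1 z /\ ham_map z = p.

Lemma ham_circle_ray b s : ham_circle (dray_pt b s).
Proof. apply ham_map_onto_ray. Qed.

Lemma ham_circle_hamilton : hamilton_circle vert gadj ham_circle.
Proof.
  split; [split|].
  - intros p (z & Hz & <-). apply ham_map_inG; auto.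
  - exists ham_map. split; [|split; [|split; [|split]]].
    + intros z Hz. exists z. auto.
    + intros p Hp. exact Hp.
    + apply ham_map_inj.
    + intros O HO z. apply ham_map_continuous; auto.
    + apply ham_map_inverse_continuous.
  - intro v. destruct (dray_surj v) as (b & m & <-). rewrite <- dray_pt_int. apply ham_circle_ray.
Qed.

(** * Uniqueness *)

Section Uniqueness.
Variable C : point vert -> Prop.
Hypothesis C_hamilton : hamilton_circle vert gadj C.

Lemma used_in_piece k n u v : nth_error (piece_edges k) n = Some (u, v) ->
  (used vert gadj C u v <-> bit ham_bits n = true).
Proof.
  intro H. rewrite <- (used_bit_spec C u v), <- (piece_bits_eq C C_hamilton k).
  unfold bit, piece_bits. assert (E : nth n (map (fun p => used_bit C (fst p) (snd p)) (piece_edges k)) false = used_bit C u v).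
  { apply nth_error_nth. rewrite nth_error_map, H. reflexivity. }
  rewrite E. tauto.
Qed.

Lemma dray_used b m : used vert gadj C (dray b m) (dray b (m + 1)).
Proof.
  destruct b. { apply (used_in_piece m 3); reflexivity. }
  destruct (bot_form m) as (q & r & Hr & ->).
  destruct (Z.eq_dec r 8) as [->|N].
  - replace (9 * q + 8 + 1)%Z with (9 * (q + 1) + 0)%Z by lia. rewrite !dray_bot by lia.
    apply (used_in_piece q 4); reflexivity.
  - rewrite <- Z.add_assoc. rewrite !dray_bot by lia.
    assert (Hn : nth_error (piece_edges q) (6 + Z.to_nat r) = Some ((q, bot_idx r), (q, bot_idx (r + 1)))
                 /\ bit ham_bits (6 + Z.to_nat r) = true).
    { cases9 r; try lia; split; reflexivity. }
    destruct Hn as [Hn Hb]. apply (used_in_piece q _ _ _ Hn). auto.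
Qed.

(** Every edge appears in [piece_edges] for the level of its first vertex, possibly reversed, and
    there the used ones are known by number. *)
Lemma used_dray u v : used vert gadj C u v ->
  exists b m, (u = dray b m /\ v = dray b (m + 1)) \/ (v = dray b m /\ u = dray b (m + 1)).
Proof.
  intro U.
  assert (Hin : exists k, In (u, v) (piece_edges k) \/ In (v, u) (piece_edges k)).
  { exists (lev u). apply piece_edges_complete; [apply U|].
    destruct U as [U _]. destruct u as [a i], v as [c j]. unfold gadj in U.
    unfold loc, lev; cbn [fst snd].
    destruct i; simpl in U; repeat destruct U as [U|U]; try contradiction; injection U; intros; subst;
      repeat match goal with |- context [Z.ltb ?p ?q] => destruct (Z.ltb_spec p q) end; lia. }
  assert (key : forall k u v, In (u, v) (piece_edges k) -> used vert gadj C u v ->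
     exists b m, u = dray b m /\ v = dray b (m + 1)).
  { clear u v U Hin. intros k u v Hin U. apply In_nth_error in Hin. destruct Hin as [n Hn].
    pose proof (proj1 (used_in_piece k n u v Hn) U) as Hb.
    assert (Hbot : forall r, (0 <= r < 8)%Z -> u = (k, bot_idx r) -> v = (k, bot_idx (r + 1)) ->
      exists b m, u = dray b m /\ v = dray b (m + 1)).
    { intros r Hr -> ->. exists false, (9 * k + r)%Z. rewrite <- Z.add_assoc. rewrite !dray_bot by lia. auto. }
    assert (Hcross : forall q, u = (q, w9) -> v = ((q + 1)%Z, w1) -> exists b m, u = dray b m /\ v = dray b (m + 1)).
    { intros q -> ->. exists false, (9 * q + 8)%Z. replace (9 * q + 8 + 1)%Z with (9 * (q + 1) + 0)%Z by lia.
      rewrite !dray_bot by lia. auto. }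
    (* The numbers with a true entry in [ham_bits] survive: 0, 1, 3, 4 and 6 to 13, in this order
       below. *)
    destruct n as [|[|[|[|[|[|[|[|[|[|[|[|[|[|[|[|[|[|n]]]]]]]]]]]]]]]]]];
      cbn in Hn; try discriminate Hb; try (injection Hn as <- <-); try (destruct n; discriminate Hn).
    - exists true, (k - 1)%Z. unfold dray. split; [auto|vert_eq].
    - apply (Hcross (k - 1)%Z); [auto|vert_eq].
    - exists true, k. auto.
    - apply (Hcross k); auto.
    - apply (Hbot 0%Z); auto; lia.
    - apply (Hbot 1%Z); auto; lia.
    - apply (Hbot 2%Z); auto; lia.
    - apply (Hbot 3%Z); auto; lia.
    - apply (Hbot 4%Z); auto; lia.
    - apply (Hbot 5%Z); auto; lia.
    - apply (Hbot 6%Z); auto; lia.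
    - apply (Hbot 7%Z); auto; lia. }
  destruct Hin as [k [Hin|Hin]].
  - destruct (key k u v Hin U) as (b & m & E). eauto.
  - destruct (key k v u Hin) as (b & m & E); eauto.
    apply used_sym; auto using gadj_sym, gadj_irrefl.
Qed.

(* Without the end, the tail of one double ray would be cut off by a single edge. *)
Lemma hamilton_contains_end sg : is_sign sg -> C (PEnd vert (the_end sg)).
Proof.
  intro Hsg. apply NNPP. intro HC.
  set (X := fun v : vert => exists m, v = dray true m /\ (0 < sg * m)%Z).
  assert (Hx : X (dray true sg)). { exists sg. split; auto. destruct Hsg as [->| ->]; lia. }
  assert (Hn : ~ X (dray true 0)).
  { intros (m & E & Hm). apply dray_inj in E. lia. }
  assert (U : used vert gadj C (dray true sg) (dray true 0)).
  { destruct Hsg as [->| ->].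
    - apply used_sym; auto using gadj_sym, gadj_irrefl. exact (dray_used true 0).
    - exact (dray_used true (-1)). }
  destruct (cut_not_single vert gadj gadj_sym gadj_irrefl C C_hamilton X) with (u0 := dray true sg) (v0 := dray true 0)
    as (u & v & Huv & (m & -> & Hm) & Xv & Hne); auto.
  (* The end [sg], to which both [X] and its complement converge, is absent by assumption, so only
     the opposite end has to be placed. *)
  - intros E HE CE. destruct (end_cases E HE) as (sg' & Hsg' & ->).
    destruct (Z.eq_dec sg' sg) as [->|N]; [contradiction|].
    right. apply (cut_side_end sg' 0); auto. intros v Hv (m & -> & Hm).
    unfold lev, dray in Hv. cbn [fst] in Hv. destruct Hsg as [->| ->], Hsg' as [->| ->]; lia.
  - apply used_dray in Huv. destruct Huv as (b & m' & [(E & ->)|(-> & E)]); apply dray_inj in E; destruct E as [<- E].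
    + destruct (Z.eq_dec (m' + 1) 0) as [E0|N0].
      * apply Hne. f_equal; f_equal; destruct Hsg as [->| ->]; lia.
      * apply Xv. exists (m' + 1)%Z. split; auto. destruct Hsg as [->| ->]; lia.
    + destruct (Z.eq_dec m' 0) as [E0|N0].
      * apply Hne. f_equal; f_equal; destruct Hsg as [->| ->]; lia.
      * apply Xv. exists m'. split; auto. destruct Hsg as [->| ->]; lia.
Qed.

(** Points of [C] are vertices, ends or inner points of used edges, all of which [ham_circle]
    contains. Conversely, vertices lie on [C] by definition, the edges of the double rays by
    [dray_used], and the ends by [hamilton_contains_end]. *)
Lemma hamilton_circle_eq p : C p <-> ham_circle p.
Proof.
  split.
  - intro Cp. destruct (inG_cases vert gadj gadj_irrefl p (proj1 (proj1 C_hamilton) p Cp))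
      as [(v & ->)|[(u & v & t & Huv & Ht & ->)|(E & HE & ->)]].
    + apply ham_circle_hamilton.
    + assert (U : used vert gadj C u v).
      { split; auto.
        apply (circle_edge_full vert gadj gadj_sym gadj_irrefl vert_infinite C C_hamilton u v t); auto; lra. }
      pose proof (adj_neq vert gadj gadj_irrefl u v Huv) as N.
      apply used_dray in U. destruct U as (b & m & [(-> & ->)|(-> & ->)]).
      * replace t with ((IZR m + t) - IZR m) by ring. rewrite <- dray_pt_eq by lra. apply ham_circle_ray.
      * rewrite ept_swap by auto.
        replace (1 - t) with ((IZR m + (1 - t)) - IZR m) by ring. rewrite <- dray_pt_eq by lra. apply ham_circle_ray.
    + destruct (end_cases E HE) as (sg & Hsg & ->). exists (IZR sg, 0).
      split; [apply S1_sign; auto|apply ham_map_end; auto].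
  - intros ([x y] & Hz & <-). destruct (S1_cases x y Hz) as [(sg & Hsg & -> & ->)|Hy].
    + rewrite ham_map_end by auto. apply hamilton_contains_end; auto.
    + rewrite ham_map_ray by auto. set (b := pos_b y). set (s := x / Rabs y).
      destruct (floor_ex s) as [m Hm]. destruct (Req_dec s (IZR m)) as [->|N].
      * rewrite dray_pt_int. apply C_hamilton.
      * rewrite (dray_pt_eq b m) by lra. destruct (dray_used b m) as [A U].
        apply (circle_edge_full vert gadj gadj_sym gadj_irrefl vert_infinite C C_hamilton _ _ (1/2)); auto; lra.
Qed.

End Uniqueness.

Theorem theorem1p11 :
  exists (V : Type) (adj : V -> V -> Prop),
    simple_graph V adj /\
    infinite_graph V /\
    connected V adj /\
    (forall v : V, has_degree V adj v 3) /\
    (forall E, is_end V adj E -> end_vertex_degree V E 3 /\ end_edge_degree V E 3) /\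
    unique_hamilton_circle V adj.
Proof.
  exists vert, gadj. repeat split.
  - apply gadj_sym.
  - apply gadj_irrefl.
  - apply vert_infinite.
  - apply graph_connected.
  - apply gadj_degree.
  - apply end_degrees; auto.
  - apply end_degrees; auto.
  - apply end_degrees; auto.
  - apply end_degrees; auto.
  - exists ham_circle. split; [apply ham_circle_hamilton|].
    intros C' HC' p. apply hamilton_circle_eq; auto.
Qed.
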